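(* Let $\mathcal{A}$ be a semi-simple rigid $K$-category and let $M\in\mathcal{A}$. There exists a unique element $\mu(M)\in \operatorname{End}(M)$ such that $$\operatorname{tr}(f)=\operatorname{Trd}_M(\mu(M)f)$$ for any $f\in\operatorname{End}(M)$. Moreover, $\mu(M)$ is central and invertible. Hence, if $(e_i)$ denotes the set of central idempotents of $A=\operatorname{End}(M)$ corresponding to its simple factors $A_i$, we may write $$\mu(M)=\sum_i\mu_i(M)e_i$$ with $\mu_i(M)\in Z_i(M)$, where $Z_i(M)$ is the centre of $A_i$.
   Context: $K$ is a field of characteristic $0$. A rigid $K$-category is an additive $K$-linear symmetric monoidal category $\mathcal{A}$ with $K$-bilinear tensor product, in which every object $M$ has a dual $M^*$, and such that $\operatorname{End}(\mathbf{1})=K$; it is not assumed abelian or pseudo-abelian (idempotent complete). The trace of $f\in\operatorname{End}(M)$ is the element $\operatorname{tr}(f)\in\operatorname{End}(\mathbf 1)=K$ given by the composition $\mathbf 1\xrightarrow{\eta}M^*\otimes M\xrightarrow{1\otimes f}M^*\otimes M\xrightarrow{R}M\otimes M^*\xrightarrow{\varepsilon}\mathbf 1$, where $R$ is the switch and $\eta,\varepsilon$ are the duality structures. $\mathcal{A}$ is semi-simple if $\operatorname{End}_{\mathcal A}(M)$ is a semi-simple ring for every $M$; these rings are then finite-dimensional semi-simple $K$-algebras. For a finite-dimensional simple $K$-algebra $A$ with centre $Z(A)$, put $\operatorname{Trd}_A=\operatorname{Tr}_{Z(A)/K}\circ\operatorname{Trd}_{A/Z(A)}$, where $\operatorname{Trd}_{A/Z(A)}$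 is the usual reduced trace of a central simple algebra. For $A=\prod A_i$ semi-simple with simple components $A_i$, put $\operatorname{Trd}_A=\sum_i\operatorname{Trd}_{A_i}$. Put $\operatorname{Trd}_M=\operatorname{Trd}_{\operatorname{End}(M)}$. *)

(* Defs.v *)
From HB Require Import structures.
From mathcomp Require Import all_boot all_order all_algebra all_field.
From mathcomp Require Import boolp classical_sets.

Set Implicit Arguments.
Unset Strict Implicit.
Unset Printing Implicit Defensive.

Import GRing.Theory.
Local Open Scope ring_scope.

(* A K-algebra, as a ring with a ring morphism from K to its centre.  The
   algType of the library is not used because it excludes the zero ring, which
   occurs here as the endomorphism ring of a zero object. *)
Record kalgebra (K : fieldType) := KAlgebra {
  kring :> pzRingType;
  kmap : {rmorphism K -> kring};
  kmap_central : forall (k : K) (x : kring), kmap k * x = x * kmap k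
}.

Definition left_ideal (R : pzRingType) (I : set R) : Prop :=
  [/\ I 0, forall x y, I x -> I y -> I (x + y)
    & forall r x, I x -> I (r * x)].

Definition two_sided_ideal (R : pzRingType) (I : set R) : Prop :=
  left_ideal I /\ forall r x, I x -> I (x * r).

Definition semisimple_ring (R : pzRingType) : Prop :=
  forall I : set R, left_ideal I -> exists J : set R,
    [/\ left_ideal J, forall x, I x -> J x -> x = 0
      & forall x, exists y z, [/\ I y, J z & x = y + z]].

Definition simple_ring (R : pzRingType) : Prop :=
  (1 : R) <> 0 /\
  forall I : set R, two_sided_ideal I ->
    (forall x, I x -> x = 0) \/ (forall x, I x).

Definition central (R : pzRingType) (x : R) : Prop :=
  forall y : R, x * y = y * x.

(* The library only has units in nonzero rings. *)
Definition invertible (R : pzRingType) (x : R) : Prop :=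
  exists y : R, x * y = 1 /\ y * x = 1.

Record central_idempotent (R : pzRingType) := CentralIdempotent {
  cidem : R;
  cidemM : cidem * cidem = cidem;
  cidemC : central cidem
}.

(* corner e is the ring R e, whose unit is e. *)
Section Corner.
Variables (R : pzRingType) (e : central_idempotent R).

Definition corner_pred : {pred R} := fun x => x * cidem e == x.

Fact corner_zmod_closed : zmod_closed corner_pred.
Proof.
split=> [|x y]; rewrite !unfold_in ?mul0r // => /eqP xe /eqP ye.
by rewrite mulrBl xe ye.
Qed.

HB.instance Definition _ :=
  GRing.isZmodClosed.Build R corner_pred corner_zmod_closed.

Record corner := Corner {cornerval : R; _ : cornerval \in corner_pred}.

HB.instance Definition _ := [isSub for cornerval].
HB.instance Definition _ := [Choice of corner by <:].
HB.instance Definition _ := [SubChoice_isSubZmodule of corner by <:].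

Fact corner_projP (x : R) : x * cidem e \in corner_pred.
Proof. by rewrite unfold_in -mulrA cidemM. Qed.

Definition corner_proj (x : R) : corner := Corner (corner_projP x).

Fact corner_mulP (x y : corner) : val x * val y \in corner_pred.
Proof. by rewrite unfold_in -mulrA; have /eqP-> := valP y. Qed.

Definition corner_mul (x y : corner) : corner := Corner (corner_mulP x y).

Fact corner_mulA : associative corner_mul.
Proof. by move=> x y z; apply: val_inj; rewrite /= mulrA. Qed.

Fact corner_mulr1 : right_id (corner_proj 1) corner_mul.
Proof. by move=> x; apply: val_inj; rewrite /= mul1r; apply/eqP/(valP x). Qed.

Fact corner_mul1r : left_id (corner_proj 1) corner_mul.
Proof.
by move=> x; apply: val_inj; rewrite /= mul1r cidemC; apply/eqP/(valP x).
Qed.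

Fact corner_mulDl : left_distributive corner_mul +%R.
Proof. by move=> x y z; apply: val_inj; rewrite /= mulrDl. Qed.

Fact corner_mulDr : right_distributive corner_mul +%R.
Proof. by move=> x y z; apply: val_inj; rewrite /= mulrDr. Qed.

HB.instance Definition _ := GRing.Zmodule_isPzRing.Build corner
  corner_mulA corner_mul1r corner_mulr1 corner_mulDl corner_mulDr.

Fact corner_proj_zmod_morphism : zmod_morphism corner_proj.
Proof. by move=> x y; apply: val_inj; rewrite /= mulrBl. Qed.

Fact corner_proj_monoid_morphism : monoid_morphism corner_proj.
Proof.
split=> // x y; apply: val_inj; rewrite /=.
by rewrite -!mulrA; congr (x * _); rewrite mulrA cidemC -mulrA cidemM -cidemC.
Qed.

HB.instance Definition _ :=
  GRing.isZmodMorphism.Build R corner corner_proj corner_proj_zmod_morphism.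
HB.instance Definition _ :=
  GRing.isMonoidMorphism.Build R corner corner_proj corner_proj_monoid_morphism.

End Corner.

Section CornerAlgebra.
Variables (K : fieldType) (A : kalgebra K) (e : central_idempotent A).

Let corner_kmap : {rmorphism K -> corner e} := corner_proj e \o @kmap K A.

Fact corner_kmap_central (k : K) (x : corner e) :
  corner_kmap k * x = x * corner_kmap k.
Proof.
apply: val_inj; rewrite /= -mulrA (cidemC e) !mulrA kmap_central.
by rewrite -!mulrA; congr (_ * _).
Qed.

Definition corner_algebra : kalgebra K := KAlgebra corner_kmap_central.

End CornerAlgebra.

(* The family of central idempotents of R corresponding to its simple factors:
   R is the direct product of the R e_i, each of which is simple. *)
Definition simple_factors (R : pzRingType) (n : nat)
    (e : 'I_n -> central_idempotent R) : Prop :=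
  [/\ \sum_i cidem (e i) = 1,
      forall i j, i != j -> cidem (e i) * cidem (e j) = 0
    & forall i, simple_ring (corner (e i))].

Definition field_trace (K : fieldType) (Z : fieldExtType K) (z : Z) : K :=
  \tr (passmx.mxof (vbasis {:Z}) (vbasis {:Z}) (amull z)).

(* The centre of a finite-dimensional simple K-algebra A, presented as a finite
   field extension of K together with its embedding in A. *)
Record centre_field (K : fieldType) (A : kalgebra K) := CentreField {
  cfield :> fieldExtType K;
  cinj : {rmorphism cfield -> A};
  cinj_scalar : forall k : K, cinj k%:A = kmap A k;
  cinj_inj : injective cinj;
  cinj_centre : forall x : A, central x <-> exists z, cinj z = x
}.

(* A splitting of the central simple Z-algebra A by a field extension L of Z,
   that is, an isomorphism of L-algebras L (x)_Z A -> M_n(L). It is given by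
   its restriction srep to A; bijectivity says that srep carries a (finite)
   Z-basis of A to an L-basis of M_n(L). *)
Record splitting (K : fieldType) (A : kalgebra K) (Z : centre_field A) :=
    Splitting {
  sfield : fieldType;
  semb : {rmorphism Z -> sfield};
  sdeg : nat;
  srep : {rmorphism A -> 'M[sfield]_sdeg};
  srep_centre : forall z : Z, srep (cinj Z z) = (semb z)%:M;
  srep_iso : exists (m : nat) (b : 'I_m -> A),
    (forall a : A, exists! c : 'rV[Z]_m,
       a = \sum_i cinj Z (c 0 i) * b i) /\
    (forall X : 'M[sfield]_sdeg, exists! c : 'rV[sfield]_m,
       X = \sum_i c 0 i *: srep (b i))
}.

(* Trd_{A/Z(A)}: the element of Z(A) whose image in L is the trace of the image
   of a in M_n(L).  Here and below, the value does not depend on the auxiliary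
   choices (splitting, model of the centre, ordering of the factors); the default
   0 of xget is only reached outside finite-dimensional semi-simple algebras. *)
Definition reduced_trace_centre (K : fieldType) (A : kalgebra K)
    (Z : centre_field A) (a : A) : Z :=
  xget 0 [set z | exists S : splitting Z, semb S z = \tr (srep S a)].

Definition reduced_trace_simple (K : fieldType) (A : kalgebra K) (a : A) : K :=
  xget 0 [set c | exists Z : centre_field A,
                    c = field_trace (reduced_trace_centre Z a)].

Definition reduced_trace (K : fieldType) (A : kalgebra K) (a : A) : K :=
  xget 0 [set c | exists (n : nat) (e : 'I_n -> central_idempotent A),
    simple_factors e /\
    c = \sum_i
      @reduced_trace_simple K (corner_algebra (e i)) (corner_proj (e i) a)].

Reserved Notation "g \oc f" (at level 40, left associativity).

Record additive_category (K : fieldType) := AdditiveCategory {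
  obj :> Type;
  hom : obj -> obj -> lmodType K;
  idm : forall M : obj, hom M M;
  comp : forall M N P : obj, hom N P -> hom M N -> hom M P
    where "g \oc f" := (comp g f);
  compA : forall (M N P Q : obj) (h : hom P Q) (g : hom N P) (f : hom M N),
    h \oc (g \oc f) = h \oc g \oc f;
  comp1m : forall (M N : obj) (f : hom M N), idm N \oc f = f;
  compm1 : forall (M N : obj) (f : hom M N), f \oc idm M = f;
  comp_linearl : forall (M N P : obj) (f : hom M N),
    linear (fun g : hom N P => g \oc f);
  comp_linearr : forall (M N P : obj) (g : hom N P),
    linear (fun f : hom M N => g \oc f);
  has_zero_object : exists M : obj, idm M = 0;
  has_biproducts : forall M N : obj, exists (P : obj)
    (iM : hom M P) (iN : hom N P) (pM : hom P M) (pN : hom P N),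
    [/\ pM \oc iM = idm M, pN \oc iN = idm N, pM \oc iN = 0, pN \oc iM = 0
      & iM \oc pM + iN \oc pN = idm P]
}.

Arguments hom {K a} M N.
Arguments idm {K a} M.
Arguments comp {K a M N P} g f.
Notation "g \oc f" := (comp g f) : ring_scope.

Definition endo (K : fieldType) (C : additive_category K) (M : C) : Type :=
  hom M M.

Section EndoAlgebra.
Variables (K : fieldType) (C : additive_category K) (M : C).

HB.instance Definition _ := GRing.Lmodule.copy (endo M) (hom M M).

Let one : endo M := idm M.
Let mul (g f : endo M) : endo M := g \oc f.

Fact endo_mulA : associative mul.
Proof. exact: compA. Qed.

Fact endo_mul1r : left_id one mul.
Proof. exact: comp1m. Qed.

Fact endo_mulr1 : right_id one mul.
Proof. exact: compm1. Qed.

Fact endo_mulDl : left_distributive mul +%R.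
Proof.
by move=> x y z; have := comp_linearl z 1 x y; rewrite !scale1r.
Qed.

Fact endo_mulDr : right_distributive mul +%R.
Proof.
by move=> x y z; have := comp_linearr x 1 y z; rewrite !scale1r.
Qed.

HB.instance Definition _ := GRing.Zmodule_isPzRing.Build (endo M)
  endo_mulA endo_mul1r endo_mulr1 endo_mulDl endo_mulDr.

Definition endo_kmap (k : K) : endo M := k *: (1 : endo M).

Fact endo_kmap_zmod_morphism : zmod_morphism endo_kmap.
Proof. by move=> x y; rewrite /endo_kmap scalerBl. Qed.

Fact endo_kmapl (k : K) (x : endo M) : endo_kmap k * x = k *: x.
Proof.
have := comp_linearl x k (1 : endo M) (0 : endo M); rewrite !addr0 => E.
by rewrite [LHS]E [X in _ + X](mul0r x) addr0; congr (_ *: _); apply: mul1r.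
Qed.

Fact endo_kmapr (k : K) (x : endo M) : x * endo_kmap k = k *: x.
Proof.
have := comp_linearr x k (1 : endo M) (0 : endo M); rewrite !addr0 => E.
by rewrite [LHS]E [X in _ + X](mulr0 x) addr0; congr (_ *: _); apply: mulr1.
Qed.

Fact endo_kmap_monoid_morphism : monoid_morphism endo_kmap.
Proof.
by split=> [|x y]; rewrite ?endo_kmapl /endo_kmap ?scale1r // scalerA.
Qed.

HB.instance Definition _ :=
  GRing.isZmodMorphism.Build K (endo M) endo_kmap endo_kmap_zmod_morphism.
HB.instance Definition _ :=
  GRing.isMonoidMorphism.Build K (endo M) endo_kmap endo_kmap_monoid_morphism.

Fact endo_kmap_central (k : K) (x : endo M) : endo_kmap k * x = x * endo_kmap k.
Proof. by rewrite endo_kmapl endo_kmapr. Qed.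

Definition endo_algebra : kalgebra K :=
  @KAlgebra K (endo M) endo_kmap endo_kmap_central.

Definition Trd (f : endo M) : K := @reduced_trace K endo_algebra f.

End EndoAlgebra.

Definition semisimple_category (K : fieldType) (C : additive_category K) :
  Prop := forall M : C, semisimple_ring (endo M).

Record tensor_data (K : fieldType) (C : additive_category K) := TensorData {
  ten : C -> C -> C;
  tenm : forall M M' N N' : C,
    hom M M' -> hom N N' -> hom (ten M N) (ten M' N');
  tunit : C;
  assoc : forall M N P : C, hom (ten (ten M N) P) (ten M (ten N P));
  associ : forall M N P : C, hom (ten M (ten N P)) (ten (ten M N) P);
  lunit : forall M : C, hom (ten tunit M) M;
  luniti : forall M : C, hom M (ten tunit M);
  runit : forall M : C, hom (ten M tunit) M;
  runiti : forall M : C, hom M (ten M tunit);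
  switch : forall M N : C, hom (ten M N) (ten N M)
}.

Arguments tenm {K C} t {M M' N N'} f g.

Record is_symmetric_monoidal (K : fieldType) (C : additive_category K)
    (T : tensor_data C) : Prop := IsSymmetricMonoidal {
  tenm_id : forall M N : C, tenm T (idm M) (idm N) = idm (ten T M N);
  tenm_comp : forall (M M' M'' N N' N'' : C) (f' : hom M' M'') (f : hom M M')
      (g' : hom N' N'') (g : hom N N'),
    tenm T (f' \oc f) (g' \oc g) = tenm T f' g' \oc tenm T f g;
  tenm_linearl : forall (M M' N N' : C) (g : hom N N'),
    linear (fun f : hom M M' => tenm T f g);
  tenm_linearr : forall (M M' N N' : C) (f : hom M M'),
    linear (fun g : hom N N' => tenm T f g);
  assocK : forall M N P : C, associ T M N P \oc assoc T M N P = idm _;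
  associK : forall M N P : C, assoc T M N P \oc associ T M N P = idm _;
  lunitK : forall M : C, luniti T M \oc lunit T M = idm _;
  lunitiK : forall M : C, lunit T M \oc luniti T M = idm _;
  runitK : forall M : C, runiti T M \oc runit T M = idm _;
  runitiK : forall M : C, runit T M \oc runiti T M = idm _;
  switchK : forall M N : C, switch T N M \oc switch T M N = idm _;
  assoc_natural : forall (M M' N N' P P' : C)
      (f : hom M M') (g : hom N N') (h : hom P P'),
    assoc T M' N' P' \oc tenm T (tenm T f g) h
      = tenm T f (tenm T g h) \oc assoc T M N P;
  lunit_natural : forall (M M' : C) (f : hom M M'),
    lunit T M' \oc tenm T (idm (tunit T)) f = f \oc lunit T M;
  runit_natural : forall (M M' : C) (f : hom M M'),
    runit T M' \oc tenm T f (idm (tunit T)) = f \oc runit T M;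
  switch_natural : forall (M M' N N' : C) (f : hom M M') (g : hom N N'),
    switch T M' N' \oc tenm T f g = tenm T g f \oc switch T M N;
  pentagon : forall M N P Q : C,
    assoc T M N (ten T P Q) \oc assoc T (ten T M N) P Q
      = tenm T (idm M) (assoc T N P Q) \oc assoc T M (ten T N P) Q
          \oc tenm T (assoc T M N P) (idm Q);
  triangle : forall M N : C,
    tenm T (idm M) (lunit T N) \oc assoc T M (tunit T) N
      = tenm T (runit T M) (idm N);
  hexagon : forall M N P : C,
    assoc T N P M \oc switch T M (ten T N P) \oc assoc T M N P
      = tenm T (idm N) (switch T M P) \oc assoc T N M P
          \oc tenm T (switch T M N) (idm P)
}.

Record rigid_category (K : fieldType) := RigidCategory {
  rc_cat :> additive_category K;
  rc_tensor : tensor_data rc_cat;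
  rc_monoidal : is_symmetric_monoidal rc_tensor;
  dual : rc_cat -> rc_cat;
  coev : forall M : rc_cat,
    hom (tunit rc_tensor) (ten rc_tensor (dual M) M);
  ev : forall M : rc_cat,
    hom (ten rc_tensor M (dual M)) (tunit rc_tensor);
  dual_triangle : forall M : rc_cat,
    lunit rc_tensor M \oc tenm rc_tensor (ev M) (idm M)
      \oc associ rc_tensor M (dual M) M
      \oc tenm rc_tensor (idm M) (coev M) \oc runiti rc_tensor M
    = idm M;
  dual_triangle' : forall M : rc_cat,
    runit rc_tensor (dual M) \oc tenm rc_tensor (idm (dual M)) (ev M)
      \oc assoc rc_tensor (dual M) M (dual M)
      \oc tenm rc_tensor (coev M) (idm (dual M)) \oc luniti rc_tensor (dual M)
    = idm (dual M);
  (* End(1) = K, through the structural map a |-> a id *)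
  scalar : endo (tunit rc_tensor) -> K;
  scalarK : cancel scalar (fun a : K => a *: (1 : endo (tunit rc_tensor)));
  scalarK' : cancel (fun a : K => a *: (1 : endo (tunit rc_tensor))) scalar
}.

Definition cat_trace (K : fieldType) (C : rigid_category K) (M : C)
    (f : endo M) : K :=
  let T := rc_tensor C in
  scalar (ev M \oc switch T (dual M) M \oc tenm T (idm (dual M)) f \oc coev M).

(* Main.v *)
Require Import Defs.
From HB Require Import structures.
From mathcomp Require Import all_boot all_order all_algebra all_field.
From mathcomp Require Import boolp classical_sets.

(** The theorem compares two linear forms on the algebra A = End(M).  Once A is
    known to be finite-dimensional over K and both the categorical trace tr and
    the reduced trace Trd are known to be linear, symmetric (t (x y) = t (y x))
    and nondegenerate, each of them represents the other: tr = Trd (mu _) and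
    Trd = tr (nu _) for unique mu and nu.  Symmetry of both forms makes mu
    central, and substituting one equation into the other makes nu its inverse
    ([compare_forms]).  Multiplying a central mu by the idempotents of the
    simple factors gives its components.

    Finiteness.  Let 1 be the unit object and P the biproduct of 1 and X.  The
    endomorphisms of P that factor through finite sums of copies of 1 form a
    two-sided ideal of the semisimple ring End(P); such an ideal has a unit, say
    the sum of the composites u_i v_i with v_i : P -> 1.  Hence every c : 1 -> P
    is the sum of the u_i (v_i c), and v_i c is in End(1) = K ([hom_span]).  The
    map sending f to (1 (x) f) eta embeds A in Hom(1, M^* (x) M).

    The categorical trace.  The zigzag identities and coherence show that every
    morphism 1 -> M^* (x) M is (1 (x) g) eta and that every morphism
    M (x) M^* -> 1 is epsilon (1 (x) h) ([coev_surjective], [ev_surjective]).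
    This gives transposes, and sliding a transpose around the loop gives
    symmetry ([loopC]).  For nondegeneracy, von Neumann regularity of End(P)
    makes the nonzero morphism (1 (x) f) eta a split monomorphism, and each
    retraction of it closes the loop of f with some g, so that tr (f g) = 1.

    The reduced trace.  In a splitting of degree n of a simple algebra with
    centre Z, the matrix algebra has trace form n times the matrix trace, so in
    characteristic 0 the reduced trace over Z is 1/n times the trace of the
    regular representation over Z, with n^2 = dim_Z A ([splitting_trace]).  This
    proves independence of all choices.  The radical of a symmetric form on a
    simple algebra is a two-sided ideal, so such a form is nondegenerate as soon
    as it does not vanish at 1; and the reduced trace of 1 is n [Z : K].

    All of this needs one splitting to exist ([central_simple_split]).  Take a
    representation of A over some extension L of Z of least positive degree.
    Its commutant is L, because an eigenspace of any other commuting matrix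
    would be a smaller representation over a larger field.  The Casimir element
    of the regular trace form then produces matrices of the commutant, that is
    scalars; this is Schur orthogonality, from which the matrix units are
    explicit combinations of the matrices of a basis of A, while nondegeneracy
    of the trace form makes these matrices independent. *)

Set Implicit Arguments.
Unset Strict Implicit.
Unset Printing Implicit Defensive.

Import GRing.Theory.
Local Open Scope ring_scope.

(** * Bases and the regular representation *)

Section Bases.
Variable K : fieldType.

Definition basis_family (V : lmodType K) m (b : 'I_m -> V) :=
  forall v, exists! c : 'rV[K]_m, v = \sum_i c 0 i *: b i.

Lemma comb_sum (V : lmodType K) m p (b : 'I_m -> V) (c : 'rV[K]_p)
    (M : 'M[K]_(p, m)) :
  \sum_i (c *m M) 0 i *: b i = \sum_j c 0 j *: \sum_i M j i *: b i.
Proof.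
under [RHS]eq_bigr do rewrite scaler_sumr.
rewrite exchange_big; apply: eq_bigr => i _ /=.
by rewrite mxE scaler_suml; apply: eq_bigr => j _; rewrite scalerA.
Qed.

(** A family of maximal size among the free ones is a basis; sizes are bounded
    because more than n vectors in the span of n vectors are dependent.  Both a
    subspace and an explicit ambient spanning family are allowed, so that the
    lemma serves centres, corners and endomorphism rings alike. *)
Lemma finite_basis (V W : lmodType K) (g : V -> W) n (w : 'I_n -> W) :
    linear g -> injective g ->
    (forall v, exists c : 'rV[K]_n, g v = \sum_i c 0 i *: w i) ->
  exists m (b : 'I_m -> V), basis_family b.
Proof.
move=> g_lin g_inj g_span.
pose G : {linear V -> W} :=
  HB.pack g (GRing.isLinear.Build K V W _ g g_lin).
pose free m (b : 'I_m -> V) :=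
  forall c : 'rV[K]_m, \sum_i c 0 i *: b i = 0 -> c = 0.
pose P m := `[< exists b : 'I_m -> V, free m b >].
have exP : exists m, P m.
  by exists 0%N; apply/asboolP; exists (fun=> 0) => c _; apply: thinmx0.
have boundP m : P m -> (m <= n)%N.
  move=> /asboolP[b b_free]; rewrite leqNgt; apply/negP => lt_nm.
  have /choice[C C_def] : forall i, exists c : 'rV[K]_n,
    g (b i) = \sum_j c 0 j *: w j by move=> i; apply: g_span.
  pose M := \matrix_i C i.
  have kerM : kermx M != 0.
    rewrite -mxrank_eq0 mxrank_ker -lt0n subn_gt0.
    exact: leq_ltn_trans (rank_leq_col M) lt_nm.
  have /row_subPn[i] : ~~ (kermx M <= (0 : 'M_m))%MS by rewrite submx0.
  rewrite submx0 => /eqP[]; apply: b_free; apply: g_inj.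
  have -> : g 0 = 0 by exact: (raddf0 G).
  transitivity (\sum_j (row i (kermx M) *m M) 0 j *: w j).
    rewrite comb_sum (_ : g _ = G (\sum_j row i (kermx M) 0 j *: b j)) //.
    rewrite linear_sum; apply: eq_bigr => j _.
    rewrite linearZ /= C_def; congr (_ *: _).
    by apply: eq_bigr => k _; rewrite !mxE.
  have /sub_kermxP-> : (row i (kermx M) <= kermx M)%MS by apply: row_sub.
  by rewrite big1 // => j _; rewrite mxE scale0r.
case: (ex_maxnP exP boundP) => m /asboolP[b b_free] m_max.
exists m, b => v.
pose b' (i : 'I_m.+1) := if unlift ord0 i is Some j then b j else v.
have : ~ free m.+1 b'.
  move=> b'_free; suff /m_max : P m.+1 by rewrite ltnn.
  by apply/asboolP; exists b'.
move/existsNP => [c /not_implyP[]].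
rewrite big_ord_recl {1}/b' unlift_none => c_rel c_neq0.
have {}c_rel : c 0 ord0 *: v + \sum_i c 0 (lift ord0 i) *: b i = 0.
  rewrite -[RHS]c_rel; congr (_ + _).
  by apply: eq_bigr => i _; rewrite /b' liftK.
have c0 : c 0 ord0 != 0.
  apply: contra_notN c_neq0 => /eqP c0; move: c_rel; rewrite c0 scale0r add0r.
  move=> c_rel; have /rowP c'0 : \row_i c 0 (lift ord0 i) = 0.
    by apply: b_free; rewrite -[RHS]c_rel; apply: eq_bigr => i _; rewrite mxE.
  apply/rowP => i; rewrite mxE.
  case: (unliftP ord0 i) => [j|] ->; last exact: c0.
  by have := c'0 j; rewrite !mxE.
exists (\row_i - ((c 0 ord0)^-1 * c 0 (lift ord0 i))); split=> [|d d_def].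
  apply: (scalerI c0); rewrite scaler_sumr.
  move/eqP: c_rel; rewrite addr_eq0 => /eqP->; rewrite -sumrN.
  apply: eq_bigr => i _; rewrite mxE scalerA mulrN mulrA divff //.
  by rewrite mul1r scaleNr.
apply/eqP; rewrite -subr_eq0; apply/eqP/b_free.
under eq_bigr do rewrite !mxE scalerBl.
rewrite sumrB -d_def; apply/eqP; rewrite subr_eq0; apply/eqP.
apply: (scalerI c0); rewrite scaler_sumr.
move/eqP: c_rel; rewrite addr_eq0 => /eqP->; rewrite -sumrN.
apply: eq_bigr => i _; rewrite scalerA mulrN mulrA divff //.
by rewrite mul1r scaleNr.
Qed.

Section Coordinates.
Variables (V : lmodType K) (m : nat) (b : 'I_m -> V) (bP : basis_family b).

Definition coords (v : V) : 'rV[K]_m := projT1 (cid (bP v)).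

Lemma coordsE v : v = \sum_i coords v 0 i *: b i.
Proof. by rewrite /coords; case: cid => c []. Qed.

Lemma coords_comb (c : 'rV[K]_m) : coords (\sum_i c 0 i *: b i) = c.
Proof. by rewrite /coords; case: cid => d [d_def]; apply. Qed.

Lemma coords_linear : linear coords.
Proof.
move=> k u v; rewrite -[RHS]coords_comb; congr coords.
rewrite {1}(coordsE u) {1}(coordsE v) scaler_sumr -big_split.
by apply: eq_bigr => i _; rewrite /= !mxE scalerDl scalerA.
Qed.

HB.instance Definition _ :=
  GRing.isLinear.Build K V 'rV[K]_m _ coords coords_linear.

Lemma coords_basis i : coords (b i) = delta_mx 0 i.
Proof.
rewrite -[RHS]coords_comb (bigD1 i) //= mxE !eqxx scale1r.
rewrite big1 ?addr0 // => j ji.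
by rewrite mxE eqxx (negPf ji) scale0r.
Qed.

Lemma comb_eq0 (c : 'rV[K]_m) : \sum_i c 0 i *: b i = 0 -> c = 0.
Proof. by move=> c0; rewrite -[c]coords_comb c0 linear0. Qed.

End Coordinates.
End Bases.

(** The zero ring is allowed as a kalgebra, so its module structure
    is carried by an alias rather than by the algebra structures that presuppose
    [1 != 0]. *)
Definition kmod (K : fieldType) (A : kalgebra K) : Type := A.

Section AlgebraModule.
Variables (K : fieldType) (A : kalgebra K).

HB.instance Definition _ := GRing.Zmodule.copy (kmod A) A.

Definition kmod_scale (k : K) (x : kmod A) : kmod A := kmap A k * (x : A).

Fact kmod_scaleA a b v : kmod_scale a (kmod_scale b v) = kmod_scale (a * b) v.
Proof. by rewrite /kmod_scale rmorphM mulrA. Qed.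

Fact kmod_scale1 : left_id 1 kmod_scale.
Proof. by move=> v; rewrite /kmod_scale rmorph1 mul1r. Qed.

Fact kmod_scaleDr : right_distributive kmod_scale +%R.
Proof. by move=> k u v; rewrite /kmod_scale [LHS]mulrDr. Qed.

Fact kmod_scaleDl v : {morph kmod_scale^~ v : a b / a + b}.
Proof. by move=> a b; rewrite /kmod_scale rmorphD [LHS]mulrDl. Qed.

HB.instance Definition _ := GRing.Zmodule_isLmodule.Build K (kmod A)
  kmod_scaleA kmod_scale1 kmod_scaleDr kmod_scaleDl.

Lemma kmodZ k (x : kmod A) : k *: x = kmap A k * (x : A) :> A.
Proof. by []. Qed.

Lemma scale_mull k (x : kmod A) (y : A) :
  (k *: x : kmod A) * y = k *: (x * y : kmod A) :> A.
Proof. by rewrite !kmodZ mulrA. Qed.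

Lemma scale_mulr k (x : kmod A) (y : A) :
  y * (k *: x : kmod A) = k *: (y * x : kmod A) :> A.
Proof. by rewrite !kmodZ !mulrA kmap_central. Qed.

Lemma comb_mull m (c : 'I_m -> K) (b : 'I_m -> kmod A) (y : A) :
  (\sum_i c i *: b i : kmod A) * y = \sum_i c i *: (b i * y : kmod A) :> A.
Proof.
by rewrite [LHS]mulr_suml; apply: eq_bigr => i _; rewrite [LHS]scale_mull.
Qed.

Lemma comb_mulr m (c : 'I_m -> K) (b : 'I_m -> kmod A) (y : A) :
  y * (\sum_i c i *: b i : kmod A) = \sum_i c i *: (y * b i : kmod A) :> A.
Proof.
by rewrite [LHS]mulr_sumr; apply: eq_bigr => i _; rewrite [LHS]scale_mulr.
Qed.

End AlgebraModule.

Lemma basis_gt0 (K : fieldType) (A : kalgebra K) m (b : 'I_m -> kmod A) :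
  basis_family b -> (1 : A) <> 0 -> (0 < m)%N.
Proof.
move=> bP A1; rewrite lt0n; apply/eqP => m0; apply: A1.
apply: (etrans (coordsE bP 1)); apply: big1 => i.
by have := ltn_ord i; rewrite [in X in (_ < X)%N]m0.
Qed.

Section RegularRepresentation.
Variables (K : fieldType) (A : kalgebra K) (m : nat) (b : 'I_m -> kmod A).
Hypothesis bP : basis_family b.

(** Right multiplication, so that acting on row coordinates from the right is a
    ring morphism and not an anti-morphism. *)
Definition regmx (a : A) : 'M[K]_m := \matrix_i coords bP (b i * a).

Lemma coords_mul x a : coords bP (x * a) = coords bP x *m regmx a.
Proof.
rewrite {1}(coordsE bP x) comb_mull linear_sum mulmx_sum_row.
by apply: eq_bigr => i _; rewrite linearZ /= rowK.
Qed.

Lemma regmx_mul x y : regmx (x * y) = regmx x *m regmx y.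
Proof. by apply/row_matrixP => i; rewrite row_mul !rowK mulrA coords_mul. Qed.

Lemma regmx_linear : linear (regmx : kmod A -> 'M[K]_m).
Proof.
move=> k x y; apply/row_matrixP => i.
by rewrite linearP /= !rowK -linearP -scale_mulr -mulrDr.
Qed.

Lemma regmx_scalar k : regmx (kmap A k) = k%:M.
Proof.
apply/row_matrixP => i.
rewrite rowK -kmap_central -scalemx1 [RHS]linearZ /= row1.
by rewrite -(coords_basis bP) -linearZ.
Qed.

Lemma regmx1 : regmx 1 = 1%:M.
Proof. by rewrite -(rmorph1 (kmap A)) regmx_scalar. Qed.

Definition regtrace (a : A) : K := \tr (regmx a).

Lemma regtrace_linear : scalar (regtrace : kmod A -> K).
Proof. by move=> k x y; rewrite /regtrace regmx_linear linearP. Qed.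

Lemma regtraceC x y : regtrace (x * y) = regtrace (y * x).
Proof. by rewrite /regtrace !regmx_mul mxtrace_mulC. Qed.

Lemma regtrace1 : regtrace 1 = m%:R.
Proof. by rewrite /regtrace regmx1 mxtrace1. Qed.

End RegularRepresentation.

(** The two change-of-basis matrices P and Q are mutually inverse; they are
    rectangular a priori, which conjugation under the trace tolerates. *)
Lemma regtrace_basis (K : fieldType) (A : kalgebra K) m (b : 'I_m -> kmod A)
    m' (b' : 'I_m' -> kmod A) (bP : basis_family b) (bP' : basis_family b') a :
  regtrace bP a = regtrace bP' a.
Proof.
pose P := \matrix_i coords bP' (b i); pose Q := \matrix_i coords bP (b' i).
have PE v : coords bP v *m P = coords bP' v.
  rewrite mulmx_sum_row {2}(coordsE bP v) linear_sum.
  by apply: eq_bigr => i _; rewrite linearZ /= rowK.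
have QE v : coords bP' v *m Q = coords bP v.
  rewrite mulmx_sum_row {2}(coordsE bP' v) linear_sum.
  by apply: eq_bigr => i _; rewrite linearZ /= rowK.
have PQ : P *m Q = 1%:M.
  by apply/row_matrixP => i; rewrite row_mul rowK QE coords_basis row1.
have Pa : P *m regmx bP' a = regmx bP a *m P.
  by apply/row_matrixP => i; rewrite !row_mul !rowK PE coords_mul.
have QP : Q *m P = 1%:M.
  by apply/row_matrixP => i; rewrite row_mul rowK PE coords_basis row1.
rewrite /regtrace -[regmx bP a]mulmx1 -PQ mulmxA -Pa -mulmxA mxtrace_mulC.
by rewrite -mulmxA QP mulmx1.
Qed.

(** * Trace forms on finite-dimensional algebras *)

Definition nondegenerate (K : fieldType) (A : kalgebra K) (t : A -> K) :=
  forall x, (forall y, t (x * y) = 0) -> x = 0.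

Section ScalarMaps.
Variables (K : fieldType) (A : kalgebra K) (t : A -> K).
Hypothesis t_lin : scalar (t : kmod A -> K).

Let tL : {scalar kmod A} :=
  HB.pack (t : kmod A -> K^o) (GRing.isLinear.Build K (kmod A) K *%R _ t_lin).

Lemma scalar0 : t 0 = 0. Proof. exact: (linear0 tL). Qed.

Lemma scalarD (x y : A) : t (x + y) = t x + t y.
Proof. exact: (linearD tL). Qed.

Lemma scalar_comb m (c : 'I_m -> K) (b : 'I_m -> kmod A) :
  t (\sum_i c i *: b i : kmod A) = \sum_i c i * t (b i).
Proof.
rewrite [LHS](linear_sum tL); apply: eq_bigr => i _.
exact: (linearZ_LR tL).
Qed.

End ScalarMaps.

(** The radical of a symmetric form is a two-sided ideal, and it does not
    contain 1. *)
Lemma simple_nondegenerate (K : fieldType) (A : kalgebra K) (t : A -> K) :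
    simple_ring A -> scalar (t : kmod A -> K) ->
    (forall x y : A, t (x * y) = t (y * x)) -> t 1 != 0 -> nondegenerate t.
Proof.
move=> [_ simpleA] t_lin tC t1.
have [] := simpleA (fun x => forall y, t (x * y) = 0).
- split; first split=> [y|x y x0 y0 z|r x x0 y] /=.
  + by rewrite mul0r scalar0.
  + by rewrite mulrDl scalarD // x0 y0 addr0.
  + by rewrite -mulrA tC -mulrA x0.
  by move=> r x x0 y /=; rewrite -mulrA x0.
- by [].
by move/(_ 1 1) => /= /eqP; rewrite mulr1 (negPf t1).
Qed.

Section Gram.
Variables (K : fieldType) (A : kalgebra K) (m : nat) (b : 'I_m -> kmod A).
Hypothesis bP : basis_family b.
Variable t : A -> K.
Hypotheses (t_lin : scalar (t : kmod A -> K)) (t_nondeg : nondegenerate t).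

Definition gram : 'M[K]_m := \matrix_(i, j) t (b i * b j).

Lemma gram_comb (c : 'rV[K]_m) j :
  (c *m gram) 0 j = t ((\sum_i c 0 i *: b i : kmod A) * b j).
Proof.
rewrite comb_mull scalar_comb // mxE; apply: eq_bigr => i _.
by rewrite mxE.
Qed.

Lemma gram_unit : gram \in unitmx.
Proof.
rewrite -row_free_unit; apply: inj_row_free => c cG.
apply: (comb_eq0 bP); apply: t_nondeg => y.
rewrite (coordsE bP y) comb_mulr scalar_comb // big1 // => j _.
by rewrite -gram_comb cG mxE mulr0.
Qed.

Lemma form_ext (x x' : A) :
  (forall l, t (x * b l) = t (x' * b l)) -> x = x'.
Proof.
move=> xx'; apply/eqP; rewrite -subr_eq0; apply/eqP/t_nondeg => y.
have -> : (x - x') * y = (-1) *: (x' * y : kmod A) + (x * y : kmod A) :> A.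
  by rewrite scaleN1r [RHS]addrC [LHS]mulrBl.
rewrite t_lin (coordsE bP y) !comb_mulr !scalar_comb // mulN1r addrC.
by apply/eqP; rewrite subr_eq0; apply/eqP/eq_bigr => l _; rewrite xx'.
Qed.

(** The coordinates of the representing element solve a linear system whose
    matrix is the invertible Gram matrix. *)
Lemma form_represents (u : A -> K) : scalar (u : kmod A -> K) ->
  exists x, forall y, u y = t (x * y).
Proof.
move=> u_lin; pose c := (\row_j u (b j)) *m invmx gram.
exists (\sum_i c 0 i *: b i : kmod A) => y.
rewrite (coordsE bP y) comb_mulr !scalar_comb //.
by apply: eq_bigr => j _; rewrite -gram_comb mulmxKV ?gram_unit // mxE.
Qed.

End Gram.

(** A divisor of least size among the nonconstant ones is irreducible, and an
    irreducible polynomial acquires a root in a finite extension. *)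
Lemma root_in_extension (L : fieldType) (p : {poly L}) : (1 < size p)%N ->
  exists (L' : fieldType) (s : {rmorphism L -> L'}) (x : L'),
    root (map_poly s p) x.
Proof.
move=> p_gt1.
pose P n := `[< exists q : {poly L}, [/\ size q = n, (1 < n)%N & q %| p] >].
have exP : exists n, P n.
  by exists (size p); apply/asboolP; exists p; rewrite dvdpp.
case: (ex_minnP exP) => n /asboolP[q [<- q_gt1 q_dvd]] q_min.
have q_irr : irreducible_poly q.
  split=> // r r_neq1 r_dvd; rewrite -dvdp_size_eqp // eqn_leq.
  have q_neq0 : q != 0 by rewrite -size_poly_gt0 ltnW.
  rewrite dvdp_leq //=; apply: q_min; apply/asboolP; exists r.
  split=> //; last exact: dvdp_trans q_dvd.
  rewrite ltn_neqAle eq_sym r_neq1 size_poly_gt0.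
  by apply: contraNneq q_neq0 => r0; rewrite -dvd0p -r0.
have [L' _ [x qx _]] := irredp_FAdjoin q_irr.
exists L', (in_alg L'), x; move: q_dvd => /dvdpP[r ->].
by rewrite rmorphM rootM /= [X in _ || X]qx orbT.
Qed.

Lemma rmorphism_of (R S : pzRingType) (f : R -> S) :
    zmod_morphism f -> monoid_morphism f ->
  exists g : {rmorphism R -> S}, g =1 f.
Proof.
move=> fB fM.
pose g : {rmorphism R -> S} := HB.pack f
  (GRing.isZmodMorphism.Build R S f fB) (GRing.isMonoidMorphism.Build R S f fM).
by exists g.
Qed.

(** * A representation with scalar commutant *)

Definition is_representation (F : fieldType) (A : kalgebra F) (L : fieldType)
    (s : {rmorphism F -> L}) n (r : {rmorphism A -> 'M[L]_n}) :=
  forall k, r (kmap A k) = (s k)%:M.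

(** The eigenspace is stable, so B r(a) = r'(a) B for a basis B of it and a
    unique matrix r'(a). *)
Lemma eigenspace_subrep (F : fieldType) (A : kalgebra F) (L : fieldType)
    (s : {rmorphism F -> L}) n (r : {rmorphism A -> 'M[L]_n}) (c : 'M[L]_n)
    (x : L) :
    is_representation s r -> (forall a, r a *m c = c *m r a) ->
  exists r' : {rmorphism A -> 'M[L]_(\rank (eigenspace c x))},
    is_representation s r'.
Proof.
move=> r_rep c_comm; set W := eigenspace c x; pose B := row_base W.
have stabW a : (B *m r a <= B)%MS.
  rewrite (eqmxMr _ (eq_row_base W)) eq_row_base.
  by apply: comm_mx_stable_eigenspace; apply/esym/c_comm.
pose r' a := B *m r a *m pinvmx B.
have r'B a : r' a *m B = B *m r a by apply: mulmxKpV.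
have B_inj := row_free_inj (row_base_free W).
have r'Z : zmod_morphism r'.
  by move=> u v; apply: B_inj; rewrite /= mulmxBl !r'B rmorphB mulmxBr.
have r'M : monoid_morphism r'.
  split=> [|u v]; apply: B_inj; rewrite /= r'B ?rmorph1 ?rmorphM.
    by rewrite mulmx1 mul1mx.
  rewrite -[r' u * r' v]/(r' u *m r' v) -[RHS]mulmxA -/B.
  by rewrite r'B [RHS]mulmxA r'B -[RHS]mulmxA.
have [g gE] := rmorphism_of r'Z r'M; exists g => k.
by apply: B_inj; rewrite gE /= r'B r_rep scalar_mxC.
Qed.

Lemma extend_rep (F : fieldType) (A : kalgebra F) (L L' : fieldType)
    (s : {rmorphism F -> L}) (s' : {rmorphism L -> L'}) n
    (r : {rmorphism A -> 'M[L]_n}) :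
    is_representation s r ->
  exists2 r' : {rmorphism A -> 'M[L']_n},
    is_representation (s' \o s) r' & forall a, r' a = map_mx s' (r a).
Proof.
move=> r_rep; pose f a := map_mx s' (r a).
have fZ : zmod_morphism f by move=> u v; rewrite /f rmorphB map_mxB.
have fM : monoid_morphism f.
  by split=> [|u v]; rewrite /f ?rmorph1 ?map_mx1 // rmorphM map_mxM.
have [r' r'E] := rmorphism_of fZ fM; exists r' => // k.
by rewrite r'E /f r_rep map_scalar_mx.
Qed.

(** Minimality ranges over all extension fields at once.  This replaces the
    algebraic closure: an eigenvalue of a commuting matrix may be adjoined
    without losing minimality. *)
Lemma absolutely_irreducible_rep (F : fieldType) (A : kalgebra F) m
    (b : 'I_m -> kmod A) : basis_family b -> (0 < m)%N ->
  exists (L : fieldType) (s : {rmorphism F -> L}) (n : nat)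
         (r : {rmorphism A -> 'M[L]_n}),
    [/\ (0 < n)%N, is_representation s r
      & forall c, (forall a, r a *m c = c *m r a) -> is_scalar_mx c].
Proof.
move=> bP m_gt0.
pose P n := `[< exists (L : fieldType) (s : {rmorphism F -> L})
  (r : {rmorphism A -> 'M[L]_n}), (0 < n)%N /\ is_representation s r >].
have exP : exists n, P n.
  exists m; apply/asboolP; exists F, idfun.
  have fZ : zmod_morphism (regmx bP).
    move=> u v; have := regmx_linear bP (-1) v u.
    by rewrite !scaleN1r [- v + u]addrC [- regmx bP v + _]addrC.
  have [r rE] := rmorphism_of fZ (regmx1 bP, regmx_mul bP).
  by exists r; split=> // k; rewrite rE regmx_scalar.
case: (ex_minnP exP) => n /asboolP[L [s [r [n_gt0 r_rep]]]] n_min.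
exists L, s, n, r; split=> // c c_comm.
have [L' [s' [x]]] :
    exists (L' : fieldType) (s' : {rmorphism L -> L'}) (x : L'),
    root (map_poly s' (char_poly c)) x.
  by apply: root_in_extension; rewrite size_char_poly.
rewrite map_char_poly -eigenvalue_root_char => c_eig.
have [r' r'_rep r'E] := extend_rep s' r_rep.
have c'_comm a : r' a *m map_mx s' c = map_mx s' c *m r' a.
  by rewrite r'E -!map_mxM c_comm.
have [r'' r''_rep] := eigenspace_subrep x r'_rep c'_comm.
have /n_min n_le : P (\rank (eigenspace (map_mx s' c) x)).
  apply/asboolP; exists L', (s' \o s), r''; split=> //.
  by rewrite lt0n mxrank_eq0.
have : \rank (map_mx s' c - x%:M) = 0%N.
  (* The eigenspace is everything, that is, the commuting matrix is x. *)
  move: n_le; rewrite mxrank_ker.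
  by case: (\rank _) => // d; rewrite leqNgt ltn_subrL n_gt0.
move/eqP; rewrite mxrank_eq0 subr_eq0 => /eqP/matrixP c_x.
apply/is_scalar_mxP; exists (c (Ordinal n_gt0) (Ordinal n_gt0)).
apply/matrixP => i j; apply: (fmorph_inj s').
have := c_x (Ordinal n_gt0) (Ordinal n_gt0); have := c_x i j.
by rewrite !mxE eqxx mulr1n rmorphMn => -> ->.
Qed.

(** * Splitting of central simple algebras in characteristic 0 *)

Lemma rmorph_comb (K : fieldType) (A : kalgebra K) (N : pzRingType)
    (phi : {rmorphism A -> N}) m (c : 'I_m -> K) (x : 'I_m -> kmod A) :
  phi (\sum_i c i *: x i : kmod A) = \sum_i phi (kmap A (c i)) * phi (x i).
Proof.
by rewrite [LHS]rmorph_sum; apply: eq_bigr => i _; apply: (rmorphM phi).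
Qed.

Section DualBasis.
Variables (F : fieldType) (A : kalgebra F) (m : nat) (b : 'I_m -> kmod A).
Hypotheses (bP : basis_family b) (t_nondeg : nondegenerate (regtrace bP)).

Let t := regtrace bP.
Let t_lin : scalar (t : kmod A -> F) := regtrace_linear bP.
Let H := invmx (gram b t).

(** The basis dual to [b] for the regular trace form; [H] is the inverse of the
    Gram matrix. *)
Definition dual_basis (j : 'I_m) : kmod A := \sum_k H j k *: b k.

Lemma dual_basisP j i : t (dual_basis j * b i) = (j == i)%:R.
Proof.
transitivity ((row j H *m gram b t) 0 i).
  rewrite gram_comb //; congr (t (_ * _)).
  by apply: eq_bigr => k _; rewrite mxE.
by rewrite -row_mul mulVmx ?gram_unit // !mxE.
Qed.

(** Left multiplication on the dual basis is the transpose of right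
    multiplication on the basis. *)
Lemma mul_dual_basis (a : A) j :
  a * dual_basis j = \sum_i regmx bP a i j *: dual_basis i :> A.
Proof.
apply: (form_ext bP t_lin t_nondeg) => l; rewrite -/t.
rewrite comb_mull scalar_comb // /t -mulrA regtraceC -mulrA -/t.
rewrite {1}(coordsE bP (b l * a)) comb_mulr scalar_comb //.
under eq_bigr do rewrite dual_basisP.
under [RHS]eq_bigr do rewrite dual_basisP.
rewrite (bigD1 j) //= eqxx mulr1 big1 ?addr0 => [|i /negPf ij]; last first.
  by rewrite eq_sym ij mulr0.
rewrite [RHS](bigD1 l) //= eqxx mulr1 big1 ?addr0 => [|i /negPf ->]; last first.
  by rewrite mulr0.
by rewrite mxE.
Qed.

(** The Casimir element, the sum of the D_j (x) b_j for a basis b and its dual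
    basis D, satisfies (a (x) 1) c = c (1 (x) a).  With [phi] a representation
    this gives matrices in the commutant, and with [phi] the identity it gives
    central elements of A. *)
Lemma casimir_central (N : pzRingType) (phi : {rmorphism A -> N}) (X : N)
    (a : A) :
    (forall k, central (phi (kmap A k))) ->
  phi a * (\sum_j phi (dual_basis j) * X * phi (b j))
    = (\sum_j phi (dual_basis j) * X * phi (b j)) * phi a.
Proof.
move=> phi_central; pose R := regmx bP a.
transitivity (\sum_j \sum_i
    phi (kmap A (R i j)) * (phi (dual_basis i) * X * phi (b j))).
  rewrite mulr_sumr; apply: eq_bigr => j _.
  rewrite !mulrA -rmorphM mul_dual_basis rmorph_comb !mulr_suml.
  by apply: eq_bigr => i _; rewrite !mulrA.
rewrite exchange_big mulr_suml; apply: eq_bigr => i _ /=.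
rewrite -mulrA -rmorphM {1}(coordsE bP (b i * a)).
rewrite (rmorph_comb phi (coords bP (b i * a) 0)) mulr_sumr.
apply: eq_bigr => j _; rewrite mxE !mulrA; congr (_ * _).
by rewrite -!mulrA phi_central mulrA.
Qed.

End DualBasis.

Lemma mulmx_delta_entry (L : fieldType) n (X Y : 'M[L]_n) q u p v :
  (X *m delta_mx q u *m Y) p v = X p q * Y u v.
Proof.
by rewrite -(mul_delta_mx (0 : 'I_1)) mulmxA -colE -mulmxA -rowE
           mxE big_ord1 !mxE.
Qed.

(** Existence of a splitting: the representation of least degree has scalar
    commutant, and Schur orthogonality turns this into bijectivity of
    L (x) A -> M_n(L). *)
Lemma central_simple_split (F : fieldType) (A : kalgebra F) m
    (b : 'I_m -> kmod A) :
    [pchar F] =i pred0 -> basis_family b -> simple_ring A ->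
    (forall x : A, central x -> exists k, kmap A k = x) ->
  exists (L : fieldType) (s : {rmorphism F -> L}) (n : nat)
         (r : {rmorphism A -> 'M[L]_n}),
    is_representation s r /\
    forall X : 'M[L]_n, exists! c : 'rV[L]_m, X = \sum_i c 0 i *: r (b i).
Proof.
move=> charF bP simpleA centreA.
have m_gt0 := basis_gt0 bP simpleA.1.
pose t := regtrace bP.
have t_lin : scalar (t : kmod A -> F) := regtrace_linear bP.
have t_nondeg : nondegenerate t.
  apply: simple_nondegenerate => //; first exact: regtraceC.
  by rewrite /t regtrace1; move/pcharf0P: charF ->; rewrite -lt0n.
have [L [s [n [r [n_gt0 r_rep r_irr]]]]] := absolutely_irreducible_rep bP m_gt0.
exists L, s, n, r; split=> //.
pose D := dual_basis bP.
have DE j : D j = \sum_k invmx (gram b t) j k *: b k by [].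
have Hsym j k : invmx (gram b t) j k = invmx (gram b t) k j.
  suff E : (invmx (gram b t))^T = invmx (gram b t) by rewrite -[in LHS]E mxE.
  rewrite trmx_inv; congr invmx; apply/matrixP => i l.
  by rewrite !mxE /t regtraceC.
have r_central k : central (r (kmap A k)).
  by move=> X; rewrite r_rep; apply: (esym (scalar_mxC _ _)).
(* The Casimir sum of the matrix unit at (q, u) has entries S p q u v.  It is
   scalar, so it is supported on p = v; the symmetry of the Casimir element
   exchanges (p, q) with (u, v), so S is also supported on q = u, with one
   common value kappa. *)
pose S p q u v := \sum_j r (D j) p q * r (b j) u v.
have Ssym p q u v : S p q u v = S u v p q.
  have SE p' q' u' v' : S p' q' u' v' =
      \sum_j \sum_k s (invmx (gram b t) j k) * (r (b k) p' q' * r (b j) u' v').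
    apply: eq_bigr => j _; rewrite DE rmorph_comb summxE mulr_suml.
    apply: eq_bigr => k _; rewrite r_rep -[_ * r (b k)]/(_ *m _).
    by rewrite mul_scalar_mx !mxE mulrA.
  rewrite !SE exchange_big; apply: eq_bigr => j _; apply: eq_bigr => k _ /=.
  by rewrite Hsym [r _ _ _ * _]mulrC.
have S_entry q u p v :
    (\sum_j r (D j) * delta_mx q u * r (b j)) p v = S p q u v.
  rewrite summxE; apply: eq_bigr => j _.
  exact: mulmx_delta_entry.
have S_scalar q u : exists k, forall p v, S p q u v = k *+ (p == v).
  have /r_irr/is_scalar_mxP[k kE] :
      forall a, r a *m (\sum_j r (D j) * delta_mx q u * r (b j))
        = (\sum_j r (D j) * delta_mx q u * r (b j)) *m r a.
    by move=> a; apply: casimir_central.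
  by exists k => p v; rewrite -S_entry kE mxE.
have [kappa kappaE] : exists kappa, forall p q u v,
    S p q u v = kappa *+ ((p == v) && (q == u)).
  pose i0 := Ordinal n_gt0; exists (S i0 i0 i0 i0) => p q u v.
  have S_diag q' u' p' v' : S p' q' u' v' = S i0 q' u' i0 *+ (p' == v').
    by have [k kE] := S_scalar q' u'; rewrite !kE eqxx.
  by rewrite S_diag Ssym S_diag -mulrnA mulnb andbC (eq_sym q).
have casE X : \sum_j r (D j) * X * r (b j) = (kappa * \tr X)%:M.
  apply/matrixP => p v; rewrite {1}(matrix_sum_delta X).
  transitivity (\sum_q \sum_u X q u * S p q u v).
    rewrite summxE; under eq_bigr => j _.
      rewrite -[_ * _ * _]/(_ *m _ *m _) mulmx_sumr mulmx_suml summxE.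
      under eq_bigr => q _.
        rewrite mulmx_sumr mulmx_suml summxE.
        under eq_bigr do rewrite -scalemxAr -scalemxAl mxE mulmx_delta_entry.
      over.
    over.
    rewrite exchange_big; apply: eq_bigr => q _.
    rewrite exchange_big; apply: eq_bigr => u _.
    by rewrite /S mulr_sumr.
  under eq_bigr do under eq_bigr do rewrite kappaE.
  rewrite mxE; case: (p == v); last first.
    by rewrite big1 // => q _; rewrite big1 // => u _; rewrite mulr0n mulr0.
  rewrite /mxtrace mulr_sumr; apply: eq_bigr => q _ /=.
  rewrite (bigD1 q) //= eqxx big1 ?addr0 => [|u /negPf uq].
    by rewrite mulrC.
  by rewrite eq_sym uq mulr0.
(* The same Casimir sum in A itself takes values in the centre, and so defines
   a form p on A.  Its image in L is kappa times the matrix trace, which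
   transports the nondegeneracy of p to the representation and shows that kappa
   is not 0. *)
have /choice[p pE] : forall a : A, exists k,
    kmap A k = \sum_j D j * a * b j.
  move=> a; apply: centreA => y.
  by have := casimir_central t_nondeg (phi := idfun) a y (@kmap_central _ _).
have s_p a : s (p a) = kappa * \tr (r a).
  have : (s (p a))%:M = (kappa * \tr (r a))%:M :> 'M_n.
    rewrite -r_rep pE rmorph_sum -casE.
    by apply: eq_bigr => j _; rewrite !rmorphM.
  by move/matrixP => /(_ (Ordinal n_gt0) (Ordinal n_gt0)); rewrite !mxE eqxx.
have s_inj := fmorph_inj s.
have p_lin : scalar (p : kmod A -> F).
  move=> k x y; apply: s_inj; rewrite rmorphD rmorphM !s_p.
  rewrite (rmorphD r) (rmorphM r) r_rep mxtraceD mulrDr.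
  by rewrite [_ * r x]mul_scalar_mx mxtraceZ mulrCA.
have p_sym (x y : A) : p (x * y) = p (y * x).
  by apply: s_inj; rewrite !s_p !rmorphM [in LHS]mxtrace_mulC.
have p1 : p 1 != 0.
  apply/eqP => p1; have /(congr1 t) := pE 1; rewrite p1 rmorph0 (scalar0 t_lin).
  rewrite (big_morph t (scalarD t_lin) (scalar0 t_lin)).
  under eq_bigr do rewrite mulr1 [t _](dual_basisP t_nondeg) eqxx.
  rewrite sumr_const card_ord => /eqP; rewrite eq_sym.
  by move/pcharf0P: charF ->; rewrite eqn0Ngt m_gt0.
have p_nondeg := simple_nondegenerate simpleA p_lin p_sym p1.
have kappa_neq0 : kappa != 0.
  by apply: contra_neq p1 => k0; apply: s_inj; rewrite s_p k0 mul0r rmorph0.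
(* A relation between the matrices r (b i) lies in the kernel of the Gram
   matrix of p, extended to L. *)
have r_free (c : 'rV[L]_m) : \sum_i c 0 i *: r (b i) = 0 -> c = 0.
  move=> c0; have Gu : map_mx s (gram b p) \in unitmx.
    by rewrite map_unitmx gram_unit.
  rewrite -[c](mulmxK Gu) (_ : c *m _ = 0) ?mul0mx //.
  apply/rowP => j; rewrite !mxE.
  transitivity (kappa * \tr ((\sum_i c 0 i *: r (b i)) *m r (b j))).
    rewrite mulmx_suml raddf_sum mulr_sumr; apply: eq_bigr => i _.
    by rewrite !mxE s_p rmorphM /= -scalemxAl mxtraceZ mulrCA.
  by rewrite c0 mul0mx mxtrace0 mulr0.
move=> X; have X_def : X = \sum_j (kappa^-1 * \tr (X *m r (D j))) *: r (b j).
  apply/matrixP => u v; rewrite summxE.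
  transitivity (kappa^-1 * \sum_q \sum_p0 X q p0 * S p0 q u v).
    rewrite (bigD1 u) //= (bigD1 v) //= kappaE !eqxx big1 => [|w /negPf wv].
      rewrite addr0 big1 ?addr0 => [|w /negPf wu]; first by rewrite mulrC mulfK.
      by rewrite big1 // => w' _; rewrite kappaE wu andbF mulr0n mulr0.
    by rewrite kappaE wv mulr0n mulr0.
  under [RHS]eq_bigr do rewrite mxE -mulrA.
  rewrite -mulr_sumr; congr (_ * _).
  under [RHS]eq_bigr do rewrite /mxtrace mulr_suml.
  rewrite [RHS]exchange_big; apply: eq_bigr => q _ /=.
  under [RHS]eq_bigr do rewrite mxE mulr_suml.
  rewrite [RHS]exchange_big; apply: eq_bigr => w _ /=.
  by rewrite mulr_sumr; apply: eq_bigr => j _; rewrite mulrA.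
exists (\row_j (kappa^-1 * \tr (X *m r (D j)))); split=> [|d d_def].
  by rewrite {1}X_def; apply: eq_bigr => j _; rewrite mxE.
apply/eqP; rewrite -subr_eq0; apply/eqP/r_free.
under eq_bigr do rewrite !mxE scalerBl.
by rewrite sumrB -d_def -X_def subrr.
Qed.

(** * The reduced trace over the centre as a regular trace *)

Lemma char0_natr_inj (F : fieldType) : [pchar F] =i pred0 ->
  injective (fun n => n%:R : F).
Proof.
move=> /pcharf0P charF m n /= mn; wlog le_mn : m n mn / (m <= n)%N.
  by move=> W; case/orP: (leq_total m n) => /W; [apply|move/(_ (esym mn))].
apply/eqP; rewrite eqn_leq le_mn -subn_eq0 -charF natrB //.
by rewrite mn subrr eqxx.
Qed.

Section MatrixAlgebra.
Variables (L : fieldType) (n : nat).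

Let mxmap : {rmorphism L -> 'M[L]_n} := @scalar_mx L n.

Fact mxmap_central k (X : 'M[L]_n) : mxmap k * X = X * mxmap k.
Proof. by apply: esym; apply: (scalar_mxC k X). Qed.

(** Viewing M_n(L) as an algebra over L makes the trace of its regular
    representation independent of the basis: it is computed once on matrix units
    and once on the images of a basis of A. *)
Definition matrix_algebra : kalgebra L := KAlgebra mxmap_central.

Lemma matrix_comb m (b : 'I_m -> 'M[L]_n) (d : 'rV[L]_m) :
  \sum_i d 0 i *: (b i : kmod matrix_algebra)
    = \sum_i d 0 i *: b i :> 'M[L]_n.
Proof. by apply: eq_bigr => i _; apply: mul_scalar_mx. Qed.

Lemma matrix_basis m (b : 'I_m -> 'M[L]_n) :
    (forall X : 'M[L]_n, exists! c : 'rV[L]_m, X = \sum_i c 0 i *: b i) ->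
  basis_family (b : 'I_m -> kmod matrix_algebra).
Proof.
move=> bP X; have [c [cE c_uniq]] := bP X.
by exists c; split=> [|d]; rewrite matrix_comb //; apply: c_uniq.
Qed.

Definition unit_matrix (k : 'I_(n * n)) : 'M[L]_n := vec_mx (delta_mx 0 k).

Lemma unit_matrix_comb (d : 'rV[L]_(n * n)) :
  \sum_i d 0 i *: unit_matrix i = vec_mx d.
Proof.
rewrite [in RHS](row_sum_delta d) linear_sum.
by apply: eq_bigr => i _; rewrite linearZ.
Qed.

Lemma unit_matrix_basis : basis_family (unit_matrix : _ -> kmod matrix_algebra).
Proof.
apply: matrix_basis => X.
exists (mxvec X); split=> [|d]; rewrite unit_matrix_comb ?mxvecK // => ->.
by rewrite vec_mxK.
Qed.

Lemma matrix_regtrace m (b : 'I_m -> kmod matrix_algebra)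
    (bP : basis_family b) X :
  regtrace bP X = n%:R * \tr (X : 'M[L]_n).
Proof.
rewrite (regtrace_basis bP unit_matrix_basis).
transitivity (\sum_(i < n) \sum_(j < n) (X : 'M[L]_n) j j); last first.
  by rewrite sumr_const card_ord mulr_natl.
rewrite /regtrace [LHS](reindex _ (curry_mxvec_bij n n)) pair_bigA.
apply: eq_bigr => -[i j] _ /=; rewrite mxE.
have -> : unit_matrix (mxvec_index i j) * X
    = \sum_k mxvec (delta_mx i j *m X) 0 k
               *: (unit_matrix k : kmod matrix_algebra) :> 'M[L]_n.
  rewrite [RHS]matrix_comb unit_matrix_comb mxvecK.
  by rewrite /unit_matrix vec_mx_delta.
rewrite coords_comb mxvecE mxE (bigD1 j) //= mxE !eqxx mul1r big1 ?addr0 //.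
by move=> k /negPf kj; rewrite mxE kj andbF mul0r.
Qed.

End MatrixAlgebra.

Section CentreAlgebra.
Variables (K : fieldType) (A : kalgebra K) (Z : centre_field A).

Fact cinj_central (z : Z) (x : A) : cinj Z z * x = x * cinj Z z.
Proof. by have [_ cz] := cinj_centre Z (cinj Z z); apply: cz; exists z. Qed.

Definition centre_algebra : kalgebra Z := KAlgebra cinj_central.

Lemma centre_basis m (b : 'I_m -> kmod A) : basis_family b ->
  exists m' (b' : 'I_m' -> kmod centre_algebra), basis_family b'.
Proof.
move=> bP; apply: (@finite_basis Z (kmod centre_algebra) (kmod centre_algebra)
  id m b) => // v.
exists (\row_i (coords bP v 0 i)%:A).
rewrite [LHS](coordsE bP v); apply: eq_bigr => i _.
by rewrite kmodZ -(cinj_scalar Z) mxE.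
Qed.

Lemma centre_char0 : [pchar K] =i pred0 -> [pchar Z] =i pred0.
Proof. by move=> charK p; rewrite (fmorph_pchar (in_alg Z)) charK. Qed.

Lemma splitting_exists m (b : 'I_m -> kmod A) :
    [pchar K] =i pred0 -> basis_family b -> simple_ring A ->
  inhabited (splitting Z).
Proof.
move=> charK /centre_basis[m' [b' bP']] simpleA.
have [] := central_simple_split (centre_char0 charK) bP' simpleA.
  by move=> x; have [zx _] := cinj_centre Z x.
move=> L [s [n [r [r_rep r_iso]]]].
exact: inhabits
  (Splitting r_rep (ex_intro _ m' (ex_intro _ b' (conj bP' r_iso)))).
Qed.

(** A splitting carries the regular representation of A over Z to that of
    M_n(L), whose trace is n times the matrix trace.  At 1 this reads m = n^2 in
    L, hence in nat, since L has characteristic 0. *)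
Lemma splitting_trace (S : splitting Z) m (b : 'I_m -> kmod centre_algebra)
    (bP : basis_family b) (a : A) :
  [pchar K] =i pred0 ->
  m = (sdeg S * sdeg S)%N /\
  (sdeg S)%:R * \tr (srep S a) = semb S (regtrace bP a).
Proof.
move=> charK; have [m0 [b0 [bP0 rP0]]] := srep_iso S.
have {}bP0 : basis_family (b0 : 'I_m0 -> kmod centre_algebra) by [].
pose r0 i : kmod (matrix_algebra (sfield S) (sdeg S)) := srep S (b0 i).
have {}rP0 : basis_family r0 by apply: matrix_basis.
have charL : [pchar (sfield S)] =i pred0.
  by move=> p; rewrite (fmorph_pchar (semb S)) centre_char0.
have regE x : regmx rP0 (srep S x) = map_mx (semb S) (regmx bP0 x).
  apply/row_matrixP => i; rewrite rowK.
  rewrite -[RHS](coords_comb rP0); congr coords.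
  rewrite /r0 -rmorphM {1}(coordsE bP0 (b0 i * x)).
  rewrite (@rmorph_comb Z centre_algebra).
  by apply: eq_bigr => j _; rewrite [_ (kmap _ _)]srep_centre !mxE.
have traceE x : (sdeg S)%:R * \tr (srep S x) = semb S (regtrace bP x).
  rewrite -(matrix_regtrace rP0) (regtrace_basis bP bP0) /regtrace regE.
  by rewrite /mxtrace rmorph_sum; apply: eq_bigr => i _; rewrite mxE.
split=> //; apply: (char0_natr_inj charL).
have := traceE 1; rewrite rmorph1 mxtrace1 regtrace1 rmorph_nat => <-.
by rewrite natrM.
Qed.

End CentreAlgebra.

(** * The reduced trace of a simple algebra *)

Section FieldTrace.
Variables (K : fieldType) (Z : fieldExtType K).

Fact field_algebra_central (k : K) (x : Z) : in_alg Z k * x = x * in_alg Z k.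
Proof. exact: mulrC. Qed.

(** Z as an algebra over K, so that the trace of Z over K is a regular
    trace, computable in any basis. *)
Definition field_algebra : kalgebra K := KAlgebra field_algebra_central.

Lemma field_algebraZ (k : K) (x : kmod field_algebra) :
  k *: x = k *: (x : Z) :> Z.
Proof. exact: mulr_algl. Qed.

Definition vbasis_fam (i : 'I_(\dim {:Z})) : kmod field_algebra :=
  (vbasis {:Z})`_i.

Lemma vbasis_fam_basis : basis_family vbasis_fam.
Proof.
have E (c : 'rV[K]_(\dim {:Z})) :
    \sum_i c 0 i *: vbasis_fam i = \sum_i c 0 i *: (vbasis {:Z})`_i :> Z.
  by apply: eq_bigr => i _; apply: field_algebraZ.
move=> x; exists (\row_i coord (vbasis {:Z}) i x); split=> [|c xE].
  apply: (etrans (coord_vbasis (memvf (x : Z)))); apply/esym; rewrite [LHS]E.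
  by apply: eq_bigr => i _; rewrite mxE.
apply/rowP => i; rewrite mxE [x]xE [X in coord _ _ X]E coord_sum_free //.
exact: basis_free (vbasisP _).
Qed.

Lemma field_trace_regtrace m (b : 'I_m -> kmod field_algebra)
    (bP : basis_family b) (z : Z) :
  field_trace z = regtrace bP z.
Proof.
rewrite (regtrace_basis bP vbasis_fam_basis); congr mxtrace.
apply/row_matrixP => i; rewrite rowK rowE passmx.mul_mxof.
set e := vbasis {:Z}; have eP : basis_of {:Z} e := vbasisP _.
have combE (c : 'rV[K]_(\dim {:Z})) :
    \sum_i c 0 i *: vbasis_fam i = passmx.vecof e c :> Z.
  by apply: eq_bigr => j _; apply: field_algebraZ.
have coordsE' x : coords vbasis_fam_basis x = passmx.rVof e x.
  rewrite -[RHS](coords_comb vbasis_fam_basis); congr coords.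
  by apply/esym; rewrite [LHS]combE passmx.rVofK.
rewrite -coordsE'; congr coords; rewrite -combE.
rewrite (bigD1 i) //= mxE !eqxx scale1r big1 ?addr0 => [|j /negPf ji].
  by rewrite lfunE /= mulrC.
by rewrite mxE ji andbF scale0r.
Qed.

End FieldTrace.

Section FieldTraceLinear.
Variables (K : fieldType) (Z : fieldExtType K).

Lemma field_trace_linear : scalar (@field_trace K Z).
Proof.
move=> k x y; rewrite !(field_trace_regtrace (@vbasis_fam_basis K Z)).
by rewrite -[k *: x]field_algebraZ regtrace_linear.
Qed.

Lemma field_trace_nat n : field_trace (n%:R : Z) = (n * \dim {:Z})%:R.
Proof.
rewrite (field_trace_regtrace (@vbasis_fam_basis K Z)).
rewrite -(rmorph_nat (kmap (field_algebra Z))) /regtrace regmx_scalar.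
by rewrite mxtrace_scalar natrM mulr_natr.
Qed.

Lemma dim_field_gt0 : (0 < \dim {:Z})%N.
Proof. exact: basis_gt0 (@vbasis_fam_basis K Z) (elimN eqP (oner_neq0 Z)). Qed.

End FieldTraceLinear.

(** An isomorphism carries a K-basis of Z to a K-basis of Z' in which it
    intertwines multiplications. *)
Lemma field_trace_iso (K : fieldType) (Z Z' : fieldExtType K)
    (g : {rmorphism Z -> Z'}) (h : Z' -> Z) (z : Z) :
  (forall k, g k%:A = k%:A) -> cancel h g -> field_trace (g z) = field_trace z.
Proof.
move=> gK hK; pose w := @vbasis_fam K Z; have wP := @vbasis_fam_basis K Z.
pose w' i : kmod (field_algebra Z') := g (w i).
have combE (c : 'rV[K]_(\dim {:Z})) :
    g (\sum_i c 0 i *: w i : kmod _) = \sum_i c 0 i *: w' i :> Z'.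
  rewrite [LHS](@rmorph_comb K (field_algebra Z)).
  by apply: eq_bigr => i _; rewrite [g _]gK.
have wP' : basis_family w'.
  move=> x; exists (coords wP (h x)); split=> [|c xE].
    by rewrite -[x in LHS]hK [in LHS](coordsE wP (h x)) combE.
  rewrite -[RHS](coords_comb wP); congr coords; apply: (fmorph_inj g).
  by rewrite hK combE.
rewrite (field_trace_regtrace wP) (field_trace_regtrace wP').
congr mxtrace; apply/row_matrixP => i; rewrite !rowK.
rewrite -[RHS](coords_comb wP'); congr coords; rewrite -combE -coordsE.
by rewrite [RHS]rmorphM.
Qed.

Section CentreFields.
Variables (K : fieldType) (A : kalgebra K).

(** Two models of the centre are canonically isomorphic, since both embed in A
    with the same image. *)
Lemma centre_field_iso (Z Z' : centre_field A) :
  exists (g : {rmorphism Z -> Z'}) (h : Z' -> Z),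
    [/\ forall z, cinj Z' (g z) = cinj Z z, forall k : K, g k%:A = k%:A
      & cancel h g].
Proof.
have transfer (Y Y' : centre_field A) :
    forall y, exists y', cinj Y' y' = cinj Y y.
  move=> y; have [cy _] := cinj_centre Y' (cinj Y y); apply: cy.
  by have [_ cy] := cinj_centre Y (cinj Y y); apply: cy; exists y.
have [f fE] := choice (transfer Z Z'); have [h hE] := choice (transfer Z' Z).
have fB : zmod_morphism f.
  by move=> x y; apply: (@cinj_inj _ _ Z'); rewrite fE !rmorphB !fE.
have fM : monoid_morphism f.
  split=> [|x y]; apply: (@cinj_inj _ _ Z'); rewrite fE ?rmorph1 //.
  by rewrite !rmorphM !fE.
have [g gE] := rmorphism_of fB fM; exists g, h; split=> [z|k|z].
- by rewrite gE fE.
- by apply: (@cinj_inj _ _ Z'); rewrite gE fE !cinj_scalar.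
by apply: (@cinj_inj _ _ Z'); rewrite gE fE hE.
Qed.

Hypotheses (charK : [pchar K] =i pred0) (simpleA : simple_ring A).
Variables (m : nat) (b : 'I_m -> kmod A).
Hypothesis bP : basis_family b.

(** The degree of a splitting is determined by n^2 = dim_Z A, so the value
    obtained from one splitting is the value obtained from any other. *)
Lemma reduced_trace_centreE (Z : centre_field A) m'
    (b' : 'I_m' -> kmod (centre_algebra Z)) (bP' : basis_family b') :
  exists n, [/\ m' = (n * n)%N, (0 < n)%N
    & forall a, reduced_trace_centre Z a = n%:R^-1 * regtrace bP' a].
Proof.
have charZ := centre_char0 Z charK.
have [S] := splitting_exists Z charK bP simpleA.
have [m'E _] := splitting_trace S bP' 0 charK.
have m'_gt0 := basis_gt0 bP' simpleA.1.
have n_gt0 : (0 < sdeg S)%N by move: m'_gt0; rewrite m'E muln_gt0 andbb.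
exists (sdeg S); split=> // a.
have nZ : (sdeg S)%:R != 0 :> Z by move/pcharf0P: charZ ->; rewrite -lt0n.
have value (S' : splitting Z) (z : Z) : semb S' z = \tr (srep S' a) ->
    z = (sdeg S)%:R^-1 * regtrace bP' a.
  move=> zE; have [m'E' traceE] := splitting_trace S' bP' a charK.
  have degE : sdeg S' = sdeg S.
    by apply/eqP; rewrite -eqn_sqr -!mulnn -m'E -m'E'.
  apply: (mulfI nZ); rewrite mulVKf //; apply: (fmorph_inj (semb S')).
  by rewrite rmorphM rmorph_nat zE -traceE -[X in X%:R * _]degE.
rewrite /reduced_trace_centre; case: xgetP => [z _ [S' /value]//|].
have [_ traceE] := splitting_trace S bP' a charK.
case/(_ ((sdeg S)%:R^-1 * regtrace bP' a)); exists S.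
rewrite rmorphM -traceE fmorphV rmorph_nat mulKf //.
by rewrite -(rmorph_nat (semb S)) fmorph_eq0.
Qed.

(** The isomorphism between two models of the centre carries the reduced trace
    over one to that over the other, by comparing both in the same family [b']
    of elements of A. *)
Lemma reduced_trace_simpleE (Z : centre_field A) (a : A) :
  reduced_trace_simple a = field_trace (reduced_trace_centre Z a).
Proof.
rewrite /reduced_trace_simple.
case: xgetP => [c _ [Z' ->]|]; last first.
  by move=> /(_ (field_trace (reduced_trace_centre Z a))) []; exists Z.
have [g [h [gE gK hK]]] := centre_field_iso Z Z'.
rewrite -(field_trace_iso _ gK hK); congr field_trace.
have [m' [b' bP']] := centre_basis Z bP.
have combE (d : 'rV[Z]_m') : \sum_i d 0 i *: b' i
    = \sum_i (g (d 0 i)) *: (b' i : kmod (centre_algebra Z')) :> A.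
  by apply: eq_bigr => i _; rewrite !kmodZ /= gE.
have bP'' : basis_family (b' : 'I_m' -> kmod (centre_algebra Z')).
  move=> x; exists (map_mx g (coords bP' x)); split=> [|d xE].
    apply: (etrans (coordsE bP' x)); rewrite combE.
    by apply: eq_bigr => i _; rewrite mxE.
  have dE : d = map_mx g (map_mx h d).
    by apply/rowP => i; rewrite !mxE hK.
  rewrite dE; congr map_mx; rewrite -[RHS](coords_comb bP'); congr coords.
  by rewrite combE xE; apply: eq_bigr => i _; rewrite mxE hK.
have [n [m'E n_gt0 ->]] := reduced_trace_centreE bP'.
have [n' [m'E' _ ->]] := reduced_trace_centreE bP''.
have -> : n' = n by apply/eqP; rewrite -eqn_sqr -!mulnn -m'E -m'E'.
rewrite rmorphM fmorphV rmorph_nat; congr (_ * _).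
rewrite /regtrace /mxtrace rmorph_sum; apply: eq_bigr => i _; rewrite !mxE.
have /rowP/(_ i) : coords bP'' (b' i * a) = map_mx g (coords bP' (b' i * a)).
  rewrite -[RHS](coords_comb bP''); congr coords.
  apply: (etrans (coordsE bP' (b' i * a))); rewrite combE.
  by apply: eq_bigr => j _; rewrite mxE.
by rewrite mxE.
Qed.

Lemma reduced_trace_simple_form (Z : centre_field A) :
  [/\ scalar (@reduced_trace_simple K A : kmod A -> K),
      forall x y : A,
        reduced_trace_simple (x * y) = reduced_trace_simple (y * x)
    & nondegenerate (@reduced_trace_simple K A)].
Proof.
have [m' [b' bP']] := centre_basis Z bP.
have [n [m'E n_gt0 trdE]] := reduced_trace_centreE bP'.
have trsE x := etrans (reduced_trace_simpleE Z x) (congr1 _ (trdE x)).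
have lin : scalar (@reduced_trace_simple K A : kmod A -> K).
  move=> k x y; rewrite !trsE -field_trace_linear; congr field_trace.
  have -> : k *: x + y = k%:A *: (x : kmod (centre_algebra Z)) + y :> A.
    by rewrite !kmodZ /= cinj_scalar.
  by rewrite regtrace_linear mulrDr mulrCA mulr_algl.
have sym (x y : A) :
    reduced_trace_simple (x * y) = reduced_trace_simple (y * x).
  by rewrite !trsE regtraceC.
split=> //; apply: simple_nondegenerate => //.
rewrite trsE regtrace1 m'E natrM mulKf; last first.
  by move/pcharf0P: (centre_char0 Z charK) ->; rewrite -lt0n.
rewrite field_trace_nat; move/pcharf0P: charK ->.
by rewrite -lt0n muln_gt0 n_gt0 dim_field_gt0.
Qed.

End CentreFields.

(** * The centre of a simple algebra as a field extension *)

Section Centre.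
Variables (K : fieldType) (A : kalgebra K) (simpleA : simple_ring A).
Variables (m : nat) (b : 'I_m -> kmod A) (bP : basis_family b).

Definition centre_pred : {pred A} := fun x => `[< central x >].

Lemma centre_predP (x : A) : reflect (central x) (x \in centre_pred).
Proof. exact: asboolP. Qed.

Fact centre_zmod_closed : zmod_closed centre_pred.
Proof.
split=> [|x y /centre_predP xC /centre_predP yC]; apply/centre_predP => z.
  by rewrite mul0r mulr0.
by rewrite mulrBl mulrBr xC yC.
Qed.

HB.instance Definition _ :=
  GRing.isZmodClosed.Build A centre_pred centre_zmod_closed.

(** The parameters are proofs: the field and vector space structures declared
    below on this type depend on them. *)
Record centre_of (sA : simple_ring A) m (b : 'I_m -> kmod A)
    (bP : basis_family b) :=
  Centre {centre_val : A; _ : centre_val \in centre_pred}.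

Notation centre := (centre_of simpleA bP).

HB.instance Definition _ := [isSub of centre for @centre_val _ _ _ _].
HB.instance Definition _ := [Choice of centre by <:].
HB.instance Definition _ := [SubChoice_isSubZmodule of centre by <:].

Lemma centreP (x : centre) : central (val x).
Proof. exact/centre_predP/(valP x). Qed.

Definition to_centre (x : A) (xC : central x) : centre :=
  Centre simpleA bP (introT (centre_predP x) xC).

Fact centre_one_central : central (1 : A).
Proof. by move=> x; rewrite mul1r mulr1. Qed.

Fact centre_mul_central (x y : centre) : central (val x * val y).
Proof.
by move=> z; rewrite -mulrA (centreP y) mulrA (centreP x) mulrA.
Qed.

Definition centre_one := to_centre centre_one_central.
Definition centre_mul x y := to_centre (centre_mul_central x y).

Fact centre_mulA : associative centre_mul.
Proof. by move=> x y z; apply: val_inj; rewrite /= mulrA. Qed.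

Fact centre_mulC : commutative centre_mul.
Proof. by move=> x y; apply: val_inj; apply: (centreP x). Qed.

Fact centre_mul1 : left_id centre_one centre_mul.
Proof. by move=> x; apply: val_inj; rewrite /= mul1r. Qed.

Fact centre_mulD : left_distributive centre_mul +%R.
Proof. by move=> x y z; apply: val_inj; rewrite /= mulrDl. Qed.

Fact centre_one_neq0 : centre_one != 0.
Proof. by apply/eqP => /(congr1 val) /=; apply: simpleA.1. Qed.

HB.instance Definition _ := GRing.Zmodule_isComNzRing.Build centre
  centre_mulA centre_mulC centre_mul1 centre_mulD centre_one_neq0.

(** The left ideal of a nonzero central element is two-sided, hence contains 1;
    the inverse so obtained is central. *)
Fact centre_inverse (x : centre) :
  exists y : centre, (x != 0 -> y * x = 1) /\ (x = 0 -> y = 0).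
Proof.
have [->|x_neq0] := eqVneq x 0; first by exists 0.
have xC := centreP x.
have [||x0] := simpleA.2 (fun a => exists r, a = r * val x).
- split; first split=> [|a a' [r ->] [r' ->]|r a [r' ->]].
  + by exists 0; rewrite mul0r.
  + by exists (r + r'); rewrite mulrDl.
  + by exists (r * r'); rewrite mulrA.
  by move=> r a [r' ->]; exists (r' * r); rewrite -!mulrA xC.
- move=> x0; case/eqP: x_neq0; apply: val_inj.
  by apply: x0; exists 1; rewrite mul1r.
have [y yx] := x0 1.
have yC : central y.
  move=> z; rewrite -[z * y]mul1r yx -(mulrA y) (mulrA (val x)) xC.
  by rewrite -(mulrA z) xC -yx mulr1.
by exists (to_centre yC); split=> [_|/eqP/idPn//]; apply: val_inj.
Qed.

Definition centre_inv (x : centre) : centre := projT1 (cid (centre_inverse x)).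

Fact centre_mulVf x : x != 0 -> centre_inv x * x = 1.
Proof. by rewrite /centre_inv; case: cid => y []. Qed.

Fact centre_inv0 : centre_inv 0 = 0.
Proof. by rewrite /centre_inv; case: cid => y [_] /= ->. Qed.

HB.instance Definition _ := GRing.ComNzRing_isField.Build centre
  centre_mulVf centre_inv0.

Fact centre_scale_central (k : K) (x : centre) : central (kmap A k * val x).
Proof. by move=> z; rewrite -mulrA (centreP x) !mulrA kmap_central. Qed.

Definition centre_scale k x := to_centre (centre_scale_central k x).

Fact centre_scaleA k l x :
  centre_scale k (centre_scale l x) = centre_scale (k * l) x.
Proof. by apply: val_inj; rewrite /= rmorphM mulrA. Qed.

Fact centre_scale1 : left_id 1 centre_scale.
Proof. by move=> x; apply: val_inj; rewrite /= rmorph1 mul1r. Qed.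

Fact centre_scaleDr : right_distributive centre_scale +%R.
Proof. by move=> k x y; apply: val_inj; rewrite /= mulrDr. Qed.

Fact centre_scaleDl x : {morph centre_scale^~ x : k l / k + l}.
Proof. by move=> k l; apply: val_inj; rewrite /= rmorphD mulrDl. Qed.

HB.instance Definition _ := GRing.Zmodule_isLmodule.Build K centre
  centre_scaleA centre_scale1 centre_scaleDr centre_scaleDl.

Fact centre_scaleAl (k : K) (x y : centre) : k *: (x * y) = (k *: x) * y.
Proof. by apply: val_inj; rewrite /= mulrA. Qed.

HB.instance Definition _ :=
  GRing.Lmodule_isLalgebra.Build K centre centre_scaleAl.
HB.instance Definition _ := GRing.Lalgebra_isComAlgebra.Build K centre.

Fact centre_finite : exists d (c : 'I_d -> centre), basis_family c.
Proof.
apply: (@finite_basis K centre (kmod A) val m b) => //; first exact: val_inj.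
by move=> x; exists (coords bP (val x)); apply: coordsE.
Qed.

Let dimc := projT1 (cid centre_finite).
Let centre_basisP := projT2 (cid (projT2 (cid centre_finite))).

Fact centre_vect_iso : Vector.axiom dimc centre.
Proof.
exists (coords centre_basisP); first exact: coords_linear.
exists (fun c : 'rV_dimc =>
  \sum_i c 0 i *: projT1 (cid (projT2 (cid centre_finite))) i).
  by move=> x; rewrite -coordsE.
by move=> c; rewrite coords_comb.
Qed.

HB.instance Definition _ := Lmodule_hasFinDim.Build K centre centre_vect_iso.

Definition centre_field_type : fieldExtType K := centre.

Lemma centre_field_exists : inhabited (centre_field A).
Proof.
have valB : zmod_morphism (val : centre_field_type -> A) by [].
have valM : monoid_morphism (val : centre_field_type -> A) by [].
have [j jE] := rmorphism_of valB valM.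
have j_scalar k : j k%:A = kmap A k by rewrite jE /= mulr1.
have j_inj : injective j by move=> x y; rewrite !jE; apply: val_inj.
have j_centre x : central x <-> exists z, j z = x.
  split=> [xC|[z <-]]; first by exists (to_centre xC); rewrite jE.
  by rewrite jE; apply: centreP.
exact: inhabits (CentreField j_scalar j_inj j_centre).
Qed.

End Centre.

(** * Simple factors and the reduced trace of a semisimple algebra *)

(** The component of 1 in a left ideal I along a complement J: for x in I the
    element x - x e is in I, and it is x f with f in J. *)
Lemma semisimple_left_unit (R : pzRingType) (I : R -> Prop) :
    semisimple_ring R -> left_ideal I ->
  exists2 e, I e & forall x, I x -> x * e = x.
Proof.
move=> ssR I_ideal; have [I0 ID IM] := I_ideal.
have [J [[J0 JD JM] IJ0 IJ]] := ssR I I_ideal.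
have [e [f [Ie Jf ef]]] := IJ 1; exists e => // x Ix.
have IB u v : I u -> I v -> I (u - v).
  by move=> Iu Iv; apply: ID => //; rewrite -mulN1r; apply: IM.
have xfE : x * f = x - x * e.
  by rewrite -[X in X - _]mulr1 ef mulrDr addrC addKr.
apply/esym/eqP; rewrite -subr_eq0 -xfE; apply/eqP/IJ0; last exact: JM.
by rewrite xfE; apply: IB => //; apply: IM.
Qed.

(** Von Neumann regularity: the right unit of the left ideal generated by y is
    a multiple s y of y. *)
Lemma semisimple_regular (R : pzRingType) (y : R) :
  semisimple_ring R -> exists s, y * s * y = y.
Proof.
move=> ssR.
have I_ideal : @left_ideal R (fun a => exists s, a = s * y).
  split=> [|a a' [r ->] [r' ->]|r a [r' ->]].
  - by exists 0; rewrite mul0r.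
  - by exists (r + r'); rewrite mulrDl.
  by exists (r * r'); rewrite mulrA.
have [e [s ->] /(_ y) ye] := semisimple_left_unit ssR I_ideal.
by exists s; rewrite -mulrA ye //; exists 1; rewrite mul1r.
Qed.

(** The right unit e of the left ideal I is central: y = (1 - e) r e satisfies
    e y = 0, and writing y = y s y with y s in I gives y = y s e y = 0. *)
Lemma semisimple_ideal (R : pzRingType) (I : R -> Prop) :
    semisimple_ring R -> two_sided_ideal I ->
  exists2 e : central_idempotent R,
    I (cidem e) & forall x, I x -> x * cidem e = x.
Proof.
move=> ssR [I_ideal IMr]; have [I0 ID IM] := I_ideal.
have [e Ie Ie1] := semisimple_left_unit ssR I_ideal.
have ee : e * e = e by apply: Ie1.
have eC : central e.
  move=> r; pose y := r * e - e * r * e.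
  have [s ysy] := semisimple_regular y ssR.
  have ey : e * y = 0 by rewrite mulrBr !mulrA ee subrr.
  have Iy : I y by rewrite /y -mulrBl; apply: IM.
  have yse : y * s * e = y * s by apply: Ie1; apply: IMr.
  have y0 : y = 0 by rewrite -ysy -yse -[LHS]mulrA ey mulr0.
  rewrite -(Ie1 (e * r)); last exact: IMr.
  by apply/esym/eqP; rewrite -subr_eq0; apply/eqP.
by exists (CentralIdempotent ee eC).
Qed.

Lemma central_idempotent_inj (R : pzRingType) (e e' : central_idempotent R) :
  cidem e = cidem e' -> e = e'.
Proof.
case: e e' => [e eM eC] [e' eM' eC'] /= ee'.
case: e' / ee' eM' eC' => eM' eC'.
by congr CentralIdempotent; apply: Prop_irrelevance.
Qed.

Section SimpleFactors.
Variables (R : pzRingType).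

Lemma factor_neq0 (e : central_idempotent R) :
  simple_ring (corner e) -> cidem e <> 0.
Proof. by move=> [e1 _] e0; apply: e1; apply: val_inj; rewrite /= mul1r. Qed.

Variables (n n' : nat) (e : 'I_n -> central_idempotent R)
  (e' : 'I_n' -> central_idempotent R).

Lemma simple_factors_inj : simple_factors e -> injective e.
Proof.
move=> [_ e_orth e_simple] i j eij.
apply: contra_notP (factor_neq0 (e_simple i)).
move=> /eqP ij; have := e_orth _ _ ij; by rewrite -eij cidemM.
Qed.

(** The central idempotent e'_j cuts a two-sided ideal out of the simple ring
    R e_i, and these ideals are not all 0 since the e'_j add up to 1. *)
Lemma simple_factors_sub : simple_factors e -> simple_factors e' ->
  forall i, exists j, cidem (e i) * cidem (e' j) = cidem (e i).
Proof.
move=> [_ _ e_simple] [e'1 _ _] i; apply: contrapT => /forallNP no_j.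
apply: (factor_neq0 (e_simple i)); rewrite -[LHS]mulr1 -e'1 mulr_sumr.
apply: big1 => j _.
have e'C := cidemC (e' j); have e'M := cidemM (e' j).
have [|all0|all] := (e_simple i).2 (fun x => val x * cidem (e' j) = val x).
- split; first split=> [|x y xE yE|r x xE]; rewrite /= ?mul0r //.
  + by rewrite mulrDl xE yE.
  + by rewrite -mulrA xE.
  by move=> r x xE; rewrite /= -mulrA -e'C mulrA xE.
- rewrite -e'C.
  apply: (congr1 val (all0 (corner_proj (e i) (cidem (e' j))) _)) => /=.
  by rewrite -mulrA -e'C mulrA e'M.
case: (no_j j); have /= := all (corner_proj (e i) 1).
by rewrite mul1r.
Qed.

End SimpleFactors.

Lemma simple_factors_eq (R : pzRingType) (n n' : nat)
    (e : 'I_n -> central_idempotent R) (e' : 'I_n' -> central_idempotent R) :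
  simple_factors e -> simple_factors e' -> forall i, exists j, e i = e' j.
Proof.
move=> eF e'F i; have [j ij] := simple_factors_sub eF e'F i.
have [i' ji'] := simple_factors_sub e'F eF j; exists j.
have ii' : i = i'.
  apply: contrapT => /eqP ii'; have [_ /(_ _ _ ii') ii'0 e_simple] := eF.
  by apply: (factor_neq0 (e_simple i)); rewrite -ij -ji' mulrA (cidemC (e i))
     -mulrA ii'0 mulr0.
by apply: central_idempotent_inj; rewrite -ij cidemC -[RHS]ji' -ii'.
Qed.

(** The decomposition into simple factors is unique up to order, which is what
    makes sums over the factors well defined. *)
Lemma simple_factors_sum (R : pzRingType) (V : nmodType) (n n' : nat)
    (e : 'I_n -> central_idempotent R) (e' : 'I_n' -> central_idempotent R)
    (G : central_idempotent R -> V) :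
  simple_factors e -> simple_factors e' -> \sum_i G (e i) = \sum_j G (e' j).
Proof.
move=> eF e'F; have [f fE] := choice (simple_factors_eq eF e'F).
have [h hE] := choice (simple_factors_eq e'F eF).
have fK : cancel f h.
  by move=> i; apply: (simple_factors_inj eF); rewrite -hE -fE.
have hK : cancel h f.
  by move=> j; apply: (simple_factors_inj e'F); rewrite -fE -hE.
rewrite [RHS](reindex f) /=; last exact: onW_bij (Bijective fK hK).
by apply: eq_bigr => i _; rewrite -fE.
Qed.

(** Decompositions of 1 whose factors are merely nonzero; a decomposition into
    simple factors is one of these with the largest number of terms. *)
Definition idempotent_family (R : pzRingType) n
    (e : 'I_n -> central_idempotent R) :=
  [/\ \sum_i cidem (e i) = 1,
      forall i j, i != j -> cidem (e i) * cidem (e j) = 0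
    & forall i, cidem (e i) <> 0].

Lemma idempotent_family_split (R : pzRingType) n
    (e : 'I_n -> central_idempotent R)
    (i : 'I_n) (g : central_idempotent R) :
    idempotent_family e -> cidem g * cidem (e i) = cidem g ->
    cidem g <> 0 -> cidem g <> cidem (e i) ->
  exists e' : 'I_n.+1 -> central_idempotent R, idempotent_family e'.
Proof.
move=> [e1 e_orth e_neq0] gei g_neq0 g_neq.
have fM : (cidem (e i) - cidem g) * (cidem (e i) - cidem g)
    = cidem (e i) - cidem g.
  by rewrite mulrBl !mulrBr !cidemM gei (cidemC (e i)) gei subrr subr0.
have fC : central (cidem (e i) - cidem g).
  by move=> x; rewrite mulrBl mulrBr (cidemC (e i)) (cidemC g).
pose h j := if j == i then CentralIdempotent fM fC else e j.
have gh j : cidem g * cidem (h j) = 0.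
  rewrite /h; case: eqVneq => [_|ji] /=.
    by rewrite mulrBr gei cidemM subrr.
  by rewrite -gei -mulrA e_orth ?mulr0 // eq_sym.
have h_orth j l : j != l -> cidem (h j) * cidem (h l) = 0.
  move=> jl; rewrite /h; case: eqVneq => [ji|ji]; case: eqVneq => [li|li] /=.
  - by rewrite ji li eqxx in jl.
  - have il : i != l by rewrite eq_sym.
    by rewrite mulrBl (e_orth i) // -gei -mulrA e_orth // mulr0 subrr.
  - by rewrite mulrBr e_orth // -gei (cidemC g) mulrA e_orth // mul0r subrr.
  by rewrite e_orth.
exists (fun k => if unlift ord0 k is Some j then h j else g); split.
- rewrite big_ord_recl unlift_none; under eq_bigr do rewrite liftK.
  rewrite -e1 (bigD1 i) //= [RHS](bigD1 i) //= /h eqxx /= addrA.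
  rewrite [cidem g + _]addrC subrK; congr (_ + _).
  by apply: eq_bigr => j /negPf ->.
- move=> k l; case: (unliftP ord0 k) => [j|] ->;
    case: (unliftP ord0 l) => [j'|] -> //.
  + by rewrite (inj_eq lift_inj); apply: h_orth.
  by rewrite (cidemC (h j)) gh.
move=> k; case: (unliftP ord0 k) => [j|] _ //; rewrite /h.
case: eqVneq => _ //= /eqP; rewrite subr_eq0 => /eqP/esym.
exact: g_neq.
Qed.

Section Decomposition.
Variables (K : fieldType) (A : kalgebra K) (m : nat) (b : 'I_m -> kmod A).
Hypothesis bP : basis_family b.

(** Nonzero orthogonal idempotents are linearly independent. *)
Lemma idempotent_family_bound n (e : 'I_n -> central_idempotent A) :
  idempotent_family e -> (n <= m)%N.
Proof.
move=> [_ e_orth e_neq0]; pose C := \matrix_i coords bP (cidem (e i)).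
suff /eqP <- : row_free C by apply: rank_leq_col.
apply: inj_row_free => c cC; apply/rowP => j; rewrite [RHS]mxE.
have e0 : \sum_i c 0 i *: (cidem (e i) : kmod A) = 0.
  rewrite (coordsE bP (\sum_i _)) linear_sum big1 // => k _.
  suff -> : (\sum_i coords bP (c 0 i *: (cidem (e i) : kmod A))) = 0.
    by rewrite mxE scale0r.
  rewrite -[RHS]cC mulmx_sum_row; apply: eq_bigr => i _.
  by rewrite linearZ /= rowK.
have : (\sum_i c 0 i *: (cidem (e i) : kmod A) : kmod A) * cidem (e j) = 0.
  by rewrite e0 mul0r.
rewrite comb_mull (bigD1 j) //= cidemM big1 => [|i ij]; last first.
  by rewrite e_orth // scaler0.
rewrite addr0 => cej; apply/eqP/negPn/negP => cj0; apply: (e_neq0 j).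
by apply: (@scalerI K (kmod A) _ cj0); rewrite [LHS]cej scaler0.
Qed.

Lemma corner_basis (e : central_idempotent A) :
  exists d (c : 'I_d -> kmod (corner_algebra e)), basis_family c.
Proof.
apply: (@finite_basis K (kmod (corner_algebra e)) (kmod A) val m b).
- move=> k x y; rewrite /= -mulrA; congr (_ * _ + _).
  by rewrite (cidemC e); apply/eqP/(valP (x : corner e)).
- exact: val_inj.
by move=> x; exists (coords bP (val x)); apply: coordsE.
Qed.

(** A proper nonzero two-sided ideal of a factor R e_i is generated by a central
    idempotent g of R, and replacing e_i by g and e_i - g would lengthen a
    decomposition of maximal length. *)
Lemma simple_factors_exist : semisimple_ring A ->
  exists n (e : 'I_n -> central_idempotent A), simple_factors e.
Proof.
move=> ssA; pose P n := `[< exists e : 'I_n -> central_idempotent A,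
  idempotent_family e >].
have exP : exists n, P n.
  have [A0|A1] := pselect ((1 : A) = 0).
    have e (i : 'I_0) : central_idempotent A by case: i.
    exists 0%N; apply/asboolP; exists e; split=> [|[]//|[]//].
    by rewrite big_ord0 A0.
  have e1C : @central A 1 by move=> x; rewrite mul1r mulr1.
  exists 1%N; apply/asboolP; exists (fun=> CentralIdempotent (mulr1 1) e1C).
  by split=> [|i j|//]; rewrite ?big_ord1 // !ord1 eqxx.
have boundP n : P n -> (n <= m)%N.
  by move=> /asboolP[e]; apply: idempotent_family_bound.
case: (ex_maxnP exP boundP) => n /asboolP[e eF] n_max.
have [e1 e_orth e_neq0] := eF; exists n, e; split=> // i; split.
  by move=> /(congr1 val) /=; rewrite mul1r; apply: e_neq0.
move=> I [[I0 ID IM] IMr].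
pose I' (x : A) := exists2 u : corner (e i), I u & x = val u.
have I'_ideal : two_sided_ideal I'.
  split; first split=> [|x y [u Iu ->] [v Iv ->]|r x [u Iu ->]].
  - by exists 0.
  - by exists (u + v); first exact: ID.
  - exists (corner_proj (e i) r * u); first exact: IM.
    by rewrite /= -mulrA (cidemC (e i)); have /eqP-> := valP u.
  move=> r x [u Iu ->]; exists (u * corner_proj (e i) r); first exact: IMr.
  by rewrite /= -(cidemC (e i) r) mulrA; have /eqP-> := valP u.
have [g [u Iu gu] gI] := semisimple_ideal ssA I'_ideal.
have [g0|g_neq0] := pselect (cidem g = 0).
  by left=> x Ix; apply: val_inj; rewrite /= -[LHS]gI ?g0 ?mulr0 //; exists x.
have gei : cidem g * cidem (e i) = cidem g by rewrite gu; apply/eqP/(valP u).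
have [g1|g_neq1] := pselect (cidem g = cidem (e i)).
  right=> x; rewrite -[x]mulr1; apply: IM; suff -> : 1 = u by [].
  by apply: val_inj; rewrite /= -gu g1 mul1r.
have /asboolP/n_max : exists e' : 'I_n.+1 -> central_idempotent A,
  idempotent_family e' by apply: idempotent_family_split eF gei g_neq0 g_neq1.
by rewrite ltnn.
Qed.

Hypotheses (charK : [pchar K] =i pred0) (ssA : semisimple_ring A).

Lemma reduced_traceE n (e : 'I_n -> central_idempotent A) (a : A) :
  simple_factors e ->
  reduced_trace a = \sum_i
    @reduced_trace_simple K (corner_algebra (e i)) (corner_proj (e i) a).
Proof.
move=> eF; pose G (f : central_idempotent A) :=
  @reduced_trace_simple K (corner_algebra f) (corner_proj f a).
rewrite /reduced_trace; case: xgetP => [c _ [n' [e' [e'F ->]]]|].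
  exact: (simple_factors_sum G e'F eF).
by move=> /(_ (\sum_i G (e i))) []; exists n, e.
Qed.

(** A factor is detected by multiplying with elements supported on it, so
    nondegeneracy holds factor by factor. *)
Lemma reduced_trace_form :
  [/\ scalar (@reduced_trace K A : kmod A -> K),
      forall x y : A, reduced_trace (x * y) = reduced_trace (y * x)
    & nondegenerate (@reduced_trace K A)].
Proof.
have [n [e eF]] := simple_factors_exist ssA.
have [e1 e_orth e_simple] := eF.
have form i : let B := corner_algebra (e i) in
    [/\ scalar (@reduced_trace_simple K B : kmod B -> K),
        forall x y : B,
          reduced_trace_simple (x * y) = reduced_trace_simple (y * x)
      & nondegenerate (@reduced_trace_simple K B)].
  have simple_i : simple_ring (corner_algebra (e i)) := e_simple i.
  have [d [c cP]] := corner_basis (e i).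
  have [Z] := centre_field_exists simple_i cP.
  exact: reduced_trace_simple_form charK simple_i _ _ cP Z.
have trdE x := reduced_traceE x eF.
split=> [k x y|x y|x x0].
- rewrite !trdE mulr_sumr -big_split; apply: eq_bigr => i _ /=.
  have [lin _ _] := form i; rewrite -lin; congr reduced_trace_simple.
  by rewrite [LHS]rmorphD [X in X + _]rmorphM.
- rewrite !trdE; apply: eq_bigr => i _; have [_ sym _] := form i.
  by rewrite rmorphM sym -rmorphM.
rewrite -[x]mulr1 -e1 mulr_sumr big1 // => i _.
have [lin _ nondeg] := form i.
suff /(congr1 val) : corner_proj (e i) x = 0 by [].
apply: nondeg => y; rewrite -[RHS](x0 (val y)) trdE (bigD1 i) //=.
rewrite [X in _ + X]big1 => [|j ji].
  rewrite addr0; congr reduced_trace_simple; apply: val_inj => /=.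
  by rewrite -!mulrA; congr (_ * _); rewrite (cidemC (e i)).
have [linj _ _] := form j.
rewrite (_ : corner_proj (e j) _ = 0) ?(scalar0 linj) //; apply: val_inj => /=.
have /eqP <- : val y * cidem (e i) == val y := valP y.
by rewrite -!mulrA (e_orth i) ?mulr0 // eq_sym.
Qed.

End Decomposition.

(** * Coherence and duality in a symmetric monoidal category *)

Local Notation hom := Defs.hom.
Local Notation compA := Defs.compA.

Section CategoryRewriting.
Variables (K : fieldType) (C : additive_category K).

(** Composites are kept left-associated; this lemma and the next one rewrite
    the last two factors of a prefix of such a composite. *)
Lemma comp_eq21 (M N P Q : C) (k : hom P Q) (g : hom N P) (f : hom M N) h :
  g \oc f = h -> k \oc g \oc f = k \oc h.
Proof. by move=> <-; rewrite compA. Qed.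

Lemma comp_eq22 (M N N' P Q : C) (k : hom P Q) (g : hom N P) (f : hom M N)
    (g' : hom N' P) (f' : hom M N') :
  g \oc f = g' \oc f' -> k \oc g \oc f = k \oc g' \oc f'.
Proof. by move=> E; rewrite -!compA E. Qed.

Lemma comp_epi (M N P : C) (f : hom M N) (f' : hom N M) (g g' : hom N P) :
  f \oc f' = idm N -> g \oc f = g' \oc f -> g = g'.
Proof. by move=> ff' gf; rewrite -[g]compm1 -[g']compm1 -ff' !compA gf. Qed.

Lemma comp_mono (M N P : C) (f : hom N P) (f' : hom P N) (g g' : hom M N) :
  f' \oc f = idm N -> f \oc g = f \oc g' -> g = g'.
Proof. by move=> ff' fg; rewrite -[g]comp1m -[g']comp1m -ff' -!compA fg. Qed.

End CategoryRewriting.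

Section Monoidal.
Variables (K : fieldType) (C : additive_category K) (T : tensor_data C).
Hypothesis HT : is_symmetric_monoidal T.

Local Notation I := (tunit T).
Local Notation "M \ox N" := (ten T M N) (at level 40, left associativity).
Local Notation "f \otm g" := (tenm T f g) (at level 38, left associativity).
Local Notation "1_ M" := (idm M) (at level 1, format "1_ M").

Lemma tenm_compl (M M' M'' N : C) (f' : hom M' M'') (f : hom M M') :
  (f' \oc f) \otm 1_N = (f' \otm 1_N) \oc (f \otm 1_N).
Proof. by rewrite -(tenm_comp HT) comp1m. Qed.

Lemma tenm_compr (M M' M'' N : C) (f' : hom M' M'') (f : hom M M') :
  1_N \otm (f' \oc f) = (1_N \otm f') \oc (1_N \otm f).
Proof. by rewrite -(tenm_comp HT) comp1m. Qed.

Lemma tenm_swap (M M' N N' : C) (f : hom M M') (g : hom N N') :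
  (f \otm 1_N') \oc (1_M \otm g) = (1_M' \otm g) \oc (f \otm 1_N).
Proof. by rewrite -!(tenm_comp HT) !comp1m !compm1. Qed.

Lemma luniti_natural (M M' : C) (f : hom M M') :
  luniti T M' \oc f = (1_I \otm f) \oc luniti T M.
Proof.
apply: (comp_mono (lunitK HT _)); rewrite !compA (lunitiK HT) comp1m.
by rewrite (lunit_natural HT) -compA (lunitiK HT) compm1.
Qed.

Lemma runiti_natural (M M' : C) (f : hom M M') :
  runiti T M' \oc f = (f \otm 1_I) \oc runiti T M.
Proof.
apply: (comp_mono (runitK HT _)); rewrite !compA (runitiK HT) comp1m.
by rewrite (runit_natural HT) -compA (runitiK HT) compm1.
Qed.

Lemma associ_natural (M M' N N' P P' : C)
    (f : hom M M') (g : hom N N') (h : hom P P') :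
  associ T M' N' P' \oc (f \otm (g \otm h))
    = ((f \otm g) \otm h) \oc associ T M N P.
Proof.
apply: (comp_mono (assocK HT _ _ _)); rewrite !compA (associK HT) comp1m.
by rewrite (assoc_natural HT) -compA (associK HT) compm1.
Qed.

Lemma unit_tensor_faithful (M N : C) (f g : hom M N) :
  1_I \otm f = 1_I \otm g -> f = g.
Proof.
move=> fg; apply: (comp_epi (lunitiK HT M)).
by rewrite -!(lunit_natural HT) fg.
Qed.

Lemma tensor_unit_faithful (M N : C) (f g : hom M N) :
  f \otm 1_I = g \otm 1_I -> f = g.
Proof.
move=> fg; apply: (comp_epi (runitiK HT M)).
by rewrite -!(runit_natural HT) fg.
Qed.

(** Kelly's coherence theorem for the left unit: after tensoring with the unit
    object it is a consequence of the pentagon and the triangle. *)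
Lemma lunit_tensor (M N : C) :
  lunit T (M \ox N) \oc assoc T I M N = lunit T M \otm 1_N.
Proof.
apply: unit_tensor_faithful; rewrite tenm_compr.
apply: (comp_epi (associK HT I (I \ox M) N)).
have aK : (assoc T I I M \otm 1_N) \oc (associ T I I M \otm 1_N) = 1_ _.
  by rewrite -tenm_compl (associK HT) (tenm_id HT).
apply: (comp_epi aK).
rewrite -(assoc_natural HT) -[RHS]compA -tenm_compl (triangle HT).
rewrite (assoc_natural HT) (tenm_id HT) -(triangle HT).
by rewrite (comp_eq21 _ (pentagon HT _ _ _ _)) !compA.
Qed.

(** The mirror image, with the unit object tensored on the right. *)
Lemma runit_tensor (M N : C) :
  (1_M \otm runit T N) \oc assoc T M N I = runit T (M \ox N).
Proof.
apply: tensor_unit_faithful; rewrite tenm_compl.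
apply: (comp_mono (assocK HT M N I)).
rewrite compA (assoc_natural HT) -(triangle HT N) tenm_compr.
rewrite -(triangle HT (M \ox N)) compA -(tenm_id HT) (assoc_natural HT).
by rewrite -[RHS]compA (pentagon HT) !compA.
Qed.

Lemma assoc_luniti (M N : C) :
  assoc T I M N \oc (luniti T M \otm 1_N) = luniti T (M \ox N).
Proof.
apply: (comp_mono (lunitK HT _)).
by rewrite compA lunit_tensor -tenm_compl !(lunitiK HT) (tenm_id HT).
Qed.

Lemma assoc_runiti (M N : C) :
  assoc T M N I \oc runiti T (M \ox N) = 1_M \otm runiti T N.
Proof.
have rK : (1_M \otm runiti T N) \oc (1_M \otm runit T N) = 1_ _.
  by rewrite -tenm_compr (runitK HT) (tenm_id HT).
apply: (comp_mono rK).
by rewrite compA runit_tensor -tenm_compr !(runitiK HT) (tenm_id HT).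
Qed.

Lemma assoc_triangle (M N : C) :
  assoc T M I N \oc (runiti T M \otm 1_N) = 1_M \otm luniti T N.
Proof.
have lK : (1_M \otm luniti T N) \oc (1_M \otm lunit T N) = 1_ _.
  by rewrite -tenm_compr (lunitK HT) (tenm_id HT).
apply: (comp_mono lK).
rewrite compA (triangle HT) -tenm_compl -tenm_compr.
by rewrite (runitiK HT) (lunitiK HT) !(tenm_id HT).
Qed.

Lemma pentagon_assocr (M N P Q : C) :
  (1_M \otm assoc T N P Q) \oc assoc T M (N \ox P) Q
    = assoc T M N (P \ox Q) \oc assoc T (M \ox N) P Q
        \oc (associ T M N P \otm 1_Q).
Proof.
by rewrite (pentagon HT) -!compA -tenm_compl (associK HT) (tenm_id HT) compm1.
Qed.

Lemma pentagon_assocl (M N P Q : C) :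
  (1_M \otm associ T N P Q) \oc assoc T M N (P \ox Q)
    = assoc T M (N \ox P) Q \oc (assoc T M N P \otm 1_Q)
        \oc associ T (M \ox N) P Q.
Proof.
apply: (comp_epi (associK HT (M \ox N) P Q)).
rewrite -compA (pentagon HT) !compA -tenm_compr (assocK HT) (tenm_id HT) comp1m.
by rewrite -[RHS]compA (assocK HT) compm1.
Qed.

Lemma lunit_associ (M N : C) :
  (lunit T M \otm 1_N) \oc associ T I M N = lunit T (M \ox N).
Proof. by rewrite -lunit_tensor -compA (associK HT) compm1. Qed.

End Monoidal.

Section Duality.
Variables (K : fieldType) (C : rigid_category K) (M : C).

Local Notation T := (rc_tensor C).
Let HT : is_symmetric_monoidal T := rc_monoidal C.
Local Notation I := (tunit T).
Local Notation "M \ox N" := (ten T M N) (at level 40, left associativity).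
Local Notation "f \otm g" := (tenm T f g) (at level 38, left associativity).
Local Notation "1_ M" := (idm M) (at level 1, format "1_ M").
Local Notation "M ^*" := (dual M).

Lemma zigzag_lunit :
  (ev M \otm 1_M) \oc associ T M M^* M \oc (1_M \otm coev M) \oc runiti T M
  = luniti T M.
Proof.
apply: (comp_mono (lunitK HT M)).
by rewrite (lunitiK HT) !compA; apply: dual_triangle.
Qed.

Lemma zigzag_runit :
  runit T M^* \oc (1_(M^*) \otm ev M) \oc assoc T M^* M M^*
    \oc (coev M \otm 1_(M^*))
  = lunit T M^*.
Proof.
apply: (comp_epi (lunitK HT M^*)); rewrite (lunitiK HT).
exact: dual_triangle'.
Qed.

(** The mate h : M^* -> M^* of w recovers w up to the automorphism
    runit o luniti of the unit object; [ev_surjective] absorbs that automorphism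
    by starting from a modified w. *)
Lemma ev_mate (w : hom (M \ox M^*) I) :
  ev M \oc (1_M \otm (runit T M^* \oc (1_(M^*) \otm w) \oc assoc T M^* M M^*
      \oc (coev M \otm 1_(M^*)) \oc luniti T M^*))
  = runit T I \oc luniti T I \oc w.
Proof.
rewrite !(tenm_compr HT) !compA.
rewrite -(assoc_triangle HT) !compA.
rewrite (comp_eq22 _ (esym (assoc_natural HT _ _ _))).
rewrite (comp_eq21 _ (pentagon_assocr HT _ _ _ _)) !compA.
rewrite (comp_eq22 _ (esym (assoc_natural HT _ _ _))).
rewrite (comp_eq21 _ (runit_tensor HT _ _)).
rewrite -(runit_natural HT) (tenm_id HT).
rewrite (comp_eq22 _ (tenm_swap HT _ _)).
rewrite -(tenm_id HT M M^*) (comp_eq22 _ (esym (assoc_natural HT _ _ _))).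
rewrite (_ : _ \oc _ = runit T I \oc (1_I \otm w) \oc assoc T I M M^*
    \oc (luniti T M \otm 1_(M^*))); last first.
  by rewrite -zigzag_lunit !(tenm_compl HT) !compA.
rewrite (comp_eq21 _ (assoc_luniti HT _ _)).
by rewrite (comp_eq22 _ (esym (luniti_natural HT _))).
Qed.

Lemma coev_mate (c : hom I (M^* \ox M)) :
  (1_(M^*) \otm (lunit T M \oc (ev M \otm 1_M) \oc associ T M M^* M
      \oc (1_M \otm c) \oc runiti T M)) \oc coev M
  = c \oc lunit T I \oc runiti T I.
Proof.
rewrite !(tenm_compr HT).
rewrite -(assoc_runiti HT) !compA.
rewrite (comp_eq22 _ (runiti_natural HT _)).
rewrite (comp_eq22 _ (esym (assoc_natural HT _ _ _))) (tenm_id HT).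
rewrite (comp_eq22 _ (esym (tenm_swap HT _ _))).
rewrite (comp_eq21 _ (pentagon_assocl HT _ _ _ _)) !compA.
rewrite (comp_eq22 _ (esym (assoc_natural HT _ _ _))).
rewrite (triangle HT).
rewrite -(tenm_id HT M^* M) (comp_eq22 _ (associ_natural HT _ _ _)).
rewrite (_ : _ \oc _ = (lunit T M^* \otm 1_M) \oc associ T I M^* M
   \oc (1_I \otm c) \oc runiti T I); last first.
  by rewrite -zigzag_runit !(tenm_compl HT).
by rewrite (lunit_associ HT) (lunit_natural HT).
Qed.

Lemma ev_surjective (w : hom (M \ox M^*) I) :
  exists h : hom M^* M^*, ev M \oc (1_M \otm h) = w.
Proof.
have := ev_mate (lunit T I \oc runiti T I \oc w).
rewrite !compA (comp_eq21 _ (lunitK HT _)) compm1 (runitiK HT) comp1m => E.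
by eexists; exact: E.
Qed.

Lemma coev_surjective (c : hom I (M^* \ox M)) :
  exists g : hom M M, (1_(M^*) \otm g) \oc coev M = c.
Proof.
have := coev_mate (c \oc (runit T I \oc luniti T I)).
rewrite !compA (comp_eq21 _ (lunitK HT _)) compm1.
rewrite (comp_eq21 _ (runitiK HT _)) compm1 => E.
by eexists; exact: E.
Qed.

(** The adjunct of a morphism 1 -> M^* (x) M is the left side below, and it
    inverts f |-> (1 (x) f) eta.  On (k (x) 1) eta it also gives f when k is a
    transpose of f for the evaluation, so the two morphisms coincide, and k is
    a transpose of f for the coevaluation as well. *)
Lemma coev_adjunct (f : hom M M) :
  lunit T M \oc (ev M \otm 1_M) \oc associ T M M^* M
    \oc (1_M \otm ((1_(M^*) \otm f) \oc coev M)) \oc runiti T M = f.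
Proof.
rewrite (tenm_compr HT) !compA (comp_eq22 _ (associ_natural HT _ _ _)).
rewrite (tenm_id HT) (comp_eq22 _ (tenm_swap HT _ _)) (lunit_natural HT).
by rewrite -!compA [X in lunit T M \oc X]compA
           [X in lunit T M \oc X]compA zigzag_lunit (lunitiK HT) compm1.
Qed.

Lemma coev_adjunct_transpose (f : hom M M) (k : hom M^* M^*) :
    ev M \oc (1_M \otm k) = ev M \oc (f \otm 1_(M^*)) ->
  lunit T M \oc (ev M \otm 1_M) \oc associ T M M^* M
    \oc (1_M \otm ((k \otm 1_M) \oc coev M)) \oc runiti T M = f.
Proof.
move=> kf; rewrite (tenm_compr HT) !compA.
rewrite (comp_eq22 _ (associ_natural HT _ _ _)).
rewrite (comp_eq21 _ (esym (tenm_compl HT _ _ _))) kf (tenm_compl HT) !compA.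
rewrite (comp_eq22 _ (esym (associ_natural HT _ _ _))) (tenm_id HT).
rewrite (comp_eq22 _ (tenm_swap HT _ _)).
rewrite (comp_eq22 _ (esym (runiti_natural HT _))).
by rewrite dual_triangle comp1m.
Qed.

Lemma coev_injective (f g : hom M M) :
  (1_(M^*) \otm f) \oc coev M = (1_(M^*) \otm g) \oc coev M -> f = g.
Proof. by move=> fg; rewrite -[f]coev_adjunct fg coev_adjunct. Qed.

Lemma coev_transpose (f : hom M M) (k : hom M^* M^*) :
    ev M \oc (1_M \otm k) = ev M \oc (f \otm 1_(M^*)) ->
  (k \otm 1_M) \oc coev M = (1_(M^*) \otm f) \oc coev M.
Proof.
move=> kf; have [g gE] := coev_surjective ((k \otm 1_M) \oc coev M).
by rewrite -(coev_adjunct_transpose kf) -gE coev_adjunct.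
Qed.

(** The trace before the identification of End(1) with K. *)
Definition loop (f : hom M M) : hom I I :=
  ev M \oc switch T M^* M \oc (1_(M^*) \otm f) \oc coev M.

Lemma loop_transpose (f g : hom M M) (k : hom M^* M^*) :
    (k \otm 1_M) \oc coev M = (1_(M^*) \otm g) \oc coev M ->
  loop (f \oc g) = ev M \oc (1_M \otm k) \oc switch T M^* M
    \oc (1_(M^*) \otm f) \oc coev M.
Proof.
move=> kg; rewrite /loop (tenm_compr HT) compA (comp_eq22 _ (esym kg)).
rewrite (comp_eq22 _ (esym (tenm_swap HT _ _))).
by rewrite (comp_eq22 _ (switch_natural HT _ _)).
Qed.

(** Slide g around the loop through its transpose: from the coevaluation, past
    the switch, to the evaluation. *)
Lemma loopC (f g : hom M M) : loop (f \oc g) = loop (g \oc f).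
Proof.
have [k kg] := ev_surjective (ev M \oc (g \otm 1_(M^*))).
rewrite (loop_transpose f (coev_transpose kg)) kg.
rewrite (comp_eq22 _ (esym (switch_natural HT _ _))).
by rewrite /loop (tenm_compr HT) compA.
Qed.

(** Every morphism M^* (x) M -> 1 closes the loop in the way some g does: move
    its transpose h back to the coevaluation. *)
Lemma loop_retraction (f : hom M M) (w : hom (M^* \ox M) I) :
  exists g, loop (f \oc g) = w \oc (1_(M^*) \otm f) \oc coev M.
Proof.
have [h hE] := ev_surjective (w \oc switch T M M^*).
have [g gE] := coev_surjective ((h \otm 1_M) \oc coev M).
exists g; rewrite (loop_transpose f (esym gE)) hE.
by rewrite (comp_eq21 _ (switchK HT _ _)) compm1.
Qed.

End Duality.

(** * The categorical trace as a symmetric form *)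

Section Additive.
Variables (K : fieldType) (C : additive_category K).

Lemma comp0l (M N P : C) (f : hom M N) : (0 : hom N P) \oc f = 0.
Proof.
have := comp_linearl f (-1) (0 : hom N P) 0.
by rewrite !scaleN1r oppr0 addr0 => {1}->; rewrite addNr.
Qed.

Lemma comp0r (M N P : C) (g : hom N P) : g \oc (0 : hom M N) = 0.
Proof.
have := comp_linearr g (-1) (0 : hom M N) 0.
by rewrite !scaleN1r oppr0 addr0 => {1}->; rewrite addNr.
Qed.

Lemma comp_addl (M N P : C) (f : hom M N) (g h : hom N P) :
  (g + h) \oc f = g \oc f + h \oc f.
Proof. by have := comp_linearl f 1 g h; rewrite !scale1r. Qed.

Lemma comp_addr (M N P : C) (g : hom N P) (f h : hom M N) :
  g \oc (f + h) = g \oc f + g \oc h.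
Proof. by have := comp_linearr g 1 f h; rewrite !scale1r. Qed.

Lemma comp_scalel (M N P : C) k (f : hom M N) (g : hom N P) :
  (k *: g) \oc f = k *: (g \oc f).
Proof. by have := comp_linearl f k g 0; rewrite !addr0 comp0l addr0. Qed.

Lemma comp_scaler (M N P : C) k (f : hom M N) (g : hom N P) :
  g \oc (k *: f) = k *: (g \oc f).
Proof. by have := comp_linearr g k f 0; rewrite !addr0 comp0r addr0. Qed.

Lemma comp_suml (M N P : C) (f : hom M N) (J : Type) (s : seq J)
    (F : J -> hom N P) :
  (\sum_(j <- s) F j) \oc f = \sum_(j <- s) F j \oc f.
Proof.
apply: (big_morph (fun g => g \oc f)) => [g h|]; first exact: comp_addl.
exact: comp0l.
Qed.

Lemma comp_sumr (M N P : C) (g : hom N P) (J : Type) (s : seq J)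
    (F : J -> hom M N) :
  g \oc (\sum_(j <- s) F j) = \sum_(j <- s) g \oc F j.
Proof.
apply: (big_morph (fun f => g \oc f)) => [f h|]; first exact: comp_addr.
exact: comp0r.
Qed.

Hypothesis ssC : semisimple_category C.
Variable I : C.
Hypothesis endI : forall f : endo I, exists k : K, f = k *: (1 : endo I).

(** Von Neumann regularity of End(I + X), applied to c seen as an endomorphism,
    gives c w c = c; and w c is in the field End(I). *)
Lemma section_retraction (X : C) (c : hom I X) :
  c <> 0 -> exists w : hom X I, w \oc c = idm I.
Proof.
move=> c_neq0.
have [P [iI [iX [pI [pX [pIiI pXiX _ _ _]]]]]] := has_biproducts I X.
pose y : hom P P := iX \oc c \oc pI.
have [s ysy] := semisimple_regular (y : endo P) (@ssC P).
pose w := pI \oc s \oc iX.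
have cwc : c \oc (w \oc c) = c.
  transitivity (pX \oc (y \oc s \oc y) \oc iI).
    by rewrite /y /w !compA pXiX comp1m -[RHS]compA pIiI compm1.
  by rewrite [y \oc s \oc y]ysy /y !compA pXiX comp1m -compA pIiI compm1.
have [k wc] := endI (w \oc c); exists w; rewrite wc.
suff -> : k = 1 by rewrite scale1r.
apply/eqP; rewrite -subr_eq0; apply/negPn/negP => k1; apply: c_neq0.
apply: (scalerI k1); rewrite scaler0 scalerBl scale1r -{2}cwc wc.
by rewrite comp_scaler compm1 subrr.
Qed.

(** The endomorphisms of I + X that factor through sums of copies of I form a
    two-sided ideal.  Its unit acts as the identity on each v : I -> I + X, and
    expanding this unit expands v in finitely many morphisms. *)
Lemma hom_span (X : C) :
  exists n (u : 'I_n -> hom I X),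
    forall c : hom I X, exists k : 'rV[K]_n, c = \sum_i k 0 i *: u i.
Proof.
have [P [iI [iX [pI [pX [pIiI pXiX _ _ _]]]]]] := has_biproducts I X.
pose J (x : endo P) := exists s : seq (hom I P * hom P I),
  x = \sum_(p <- s) p.1 \oc p.2.
have J_ideal : two_sided_ideal J.
  split; first split=> [|x y [s ->] [t ->]|r x [s ->]].
  - by exists [::]; rewrite big_nil.
  - by exists (s ++ t); rewrite big_cat.
  - exists [seq (r \oc p.1, p.2) | p <- s]; rewrite big_map /=.
    by rewrite [LHS]comp_sumr; apply: eq_bigr => p _; rewrite compA.
  move=> r x [s ->]; exists [seq (p.1, p.2 \oc r) | p <- s]; rewrite big_map /=.
  by rewrite [LHS]comp_suml; apply: eq_bigr => p _; rewrite compA.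
have [e [s es] eJ] := semisimple_ideal (@ssC P) J_ideal.
exists (size s), (fun i => pX \oc (tnth (in_tuple s) i).1) => c.
pose v := iX \oc c.
have ev : (cidem e : hom P P) \oc v = v.
  have /eJ : J (v \oc pI) by exists [:: (v, pI)]; rewrite big_seq1.
  rewrite -(cidemC e) => /(congr1 (fun y : hom P P => y \oc iI)).
  by rewrite -[_ * _]/(_ \oc (v \oc pI)) -!compA pIiI !compm1.
have /choice[k kE] : forall i : 'I_(size s), exists k : K,
    ((tnth (in_tuple s) i).2 \oc v : endo I) = k *: (1 : endo I).
  by move=> i; apply: endI.
exists (\row_i k i); rewrite -[c]comp1m -pXiX -compA -/v -{1}ev es.
rewrite big_tnth comp_suml comp_sumr; apply: eq_bigr => i _.
by rewrite mxE -compA [_ \oc v]kE comp_scaler compm1 comp_scaler.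
Qed.

End Additive.

Section Trace.
Variables (K : fieldType) (C : rigid_category K) (M : C).
Local Notation T := (rc_tensor C).
Let HT : is_symmetric_monoidal T := rc_monoidal C.
Hypothesis ssC : semisimple_category C.

Lemma endo_scaleE k (f : kmod (endo_algebra M)) :
  k *: f = k *: (f : hom M M) :> hom M M.
Proof. exact: (endo_kmapl k (f : endo M)). Qed.

Lemma cat_traceE (f : endo M) : cat_trace f = Defs.scalar (loop f).
Proof. by []. Qed.

Lemma unit_endo_scalar (f : endo (tunit T)) :
  exists k : K, f = k *: (1 : endo (tunit T)).
Proof. by exists (Defs.scalar f); rewrite scalarK. Qed.

Lemma endo_basis : exists m (b : 'I_m -> kmod (endo_algebra M)), basis_family b.
Proof.
have [n [u uP]] := hom_span ssC unit_endo_scalar (ten T (dual M) M).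
pose g (f : kmod (endo_algebra M)) :=
  tenm T (idm (dual M)) (f : hom M M) \oc coev M.
apply: (@finite_basis K _ _ g n u) => [k f h|f h|f]; last exact: uP.
  rewrite /g -comp_scalel -comp_addl; congr (_ \oc _).
  have := tenm_linearr HT (idm (dual M)) k (f : hom M M) h.
  by rewrite -endo_scaleE.
exact: coev_injective.
Qed.

Lemma cat_trace_linear : scalar (@cat_trace K C M : kmod (endo_algebra M) -> K).
Proof.
move=> k f h; rewrite !cat_traceE.
have -> : loop (k *: f + h : kmod (endo_algebra M)) = k *: loop f + loop h.
  rewrite /loop; have := tenm_linearr HT (idm (dual M)) k (f : hom M M) h.
  rewrite -endo_scaleE => ->.
  by rewrite comp_addr comp_scaler comp_addl comp_scalel.
have [a ->] := unit_endo_scalar (loop f).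
have [c ->] := unit_endo_scalar (loop h).
by rewrite scalerA -scalerDl !scalarK'.
Qed.

Lemma cat_traceC (f g : endo M) : cat_trace (f * g) = cat_trace (g * f).
Proof. by rewrite !cat_traceE [loop _]loopC. Qed.

Lemma cat_trace_nondegenerate :
  nondegenerate (@cat_trace K C M : endo_algebra M -> K).
Proof.
move=> f f0; apply: contrapT => f_neq0.
have [|w w1] := section_retraction ssC unit_endo_scalar
    (c := tenm T (idm (dual M)) (f : hom M M) \oc coev M).
  move=> c0; apply: f_neq0; apply: coev_injective; rewrite c0.
  have := tenm_linearr HT (idm (dual M)) (-1) (0 : hom M M) 0.
  by rewrite !scaleN1r oppr0 addr0 addNr => ->; rewrite comp0l.
have [g gE] := loop_retraction f w.
have := f0 g; rewrite cat_traceE [loop _]gE -compA w1.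
have -> : idm (tunit T) = 1 *: (1 : endo (tunit T)) by rewrite scale1r.
by rewrite scalarK'; apply/eqP; rewrite oner_eq0.
Qed.

End Trace.

Section ComparingForms.
Variables (K : fieldType) (A : kalgebra K) (m : nat) (b : 'I_m -> kmod A).
Hypothesis bP : basis_family b.
Variables t u : A -> K.
Hypothesis t_lin : scalar (t : kmod A -> K).
Hypothesis u_lin : scalar (u : kmod A -> K).
Hypotheses (tC : forall x y : A, t (x * y) = t (y * x))
  (uC : forall x y : A, u (x * y) = u (y * x)).
Hypotheses (t_nondeg : nondegenerate t) (u_nondeg : nondegenerate u).

Lemma nondegenerate_inj (x x' : A) :
  (forall y, u (x * y) = u (x' * y)) -> x = x'.
Proof. by move=> xx'; apply: (form_ext bP u_lin u_nondeg) => l; apply: xx'. Qed.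

(** Each form represents the other.  Centrality of mu comes from
    u (mu x y) = t (x y) = t (y x) = u (mu y x) = u (x mu y). *)
Lemma compare_forms : exists mu : A,
  [/\ unique (fun x : A => forall y, t y = u (x * y)) mu, central mu
    & invertible mu].
Proof.
have [mu muE] := form_represents bP u_lin u_nondeg t_lin.
have [nu nuE] := form_represents bP t_lin t_nondeg u_lin.
exists mu; split.
- by split=> // x xE; apply: nondegenerate_inj => y; rewrite -muE xE.
- move=> x; apply: nondegenerate_inj => y.
  by rewrite -mulrA -muE tC muE mulrA uC mulrA.
exists nu; split; last first.
  apply: (form_ext bP t_lin t_nondeg) => l.
  by rewrite -mulrA -nuE -muE mul1r.
by apply: nondegenerate_inj => y; rewrite -mulrA -muE -nuE mul1r.
Qed.

End ComparingForms.

Theorem proposition1p2 (K : fieldType) (charK0 : [pchar K] =i pred0)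
    (C : rigid_category K) (ssC : semisimple_category C) (M : C) :
  exists mu : endo M,
    [/\ unique (fun m : endo M =>
          forall f : endo M, cat_trace f = Trd (m * f)) mu,
        central mu,
        invertible mu
      & (exists (n : nat) (e : 'I_n -> central_idempotent (endo M)),
           simple_factors e) /\
        (forall (n : nat) (e : 'I_n -> central_idempotent (endo M)),
           simple_factors e ->
           exists mu_ : forall i : 'I_n, corner (e i),
             (forall i, central (mu_ i)) /\
             mu = \sum_i val (mu_ i) * cidem (e i))].
Proof.
have [m [b bP]] := endo_basis M ssC.
have ssM : semisimple_ring (endo_algebra M) := @ssC M.
have [trd_lin trdC trd_nondeg] := reduced_trace_form bP charK0 ssM.
have tr_lin := @cat_trace_linear K C M.
have tr_nondeg := @cat_trace_nondegenerate K C M ssC.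
have [mu [mu_unique mu_central mu_inv]] :=
  compare_forms bP tr_lin trd_lin (@cat_traceC K C M) trdC tr_nondeg trd_nondeg.
exists mu; split=> //; split; first exact: (simple_factors_exist bP ssM).
move=> n e [e1 _ _]; exists (fun i => corner_proj (e i) mu); split=> [i x|].
  have /eqP xe : val x * cidem (e i) == val x := valP x.
  have ex : cidem (e i) * val x = val x by rewrite cidemC.
  by apply: val_inj; rewrite /= -[LHS]mulrA ex mulrA -mu_central -mulrA xe.
rewrite -[LHS]mulr1 -e1 mulr_sumr; apply: eq_bigr => i _.
by rewrite /= -mulrA cidemM.
Qed.
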